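(* Let $\Gamma$ be an EAFC system with finite vertex set, $g\in G_\Gamma$ and $n\in\mathbb{Z}\setminus\{0\}$. Then $P(g)=P(g^n)$.
   Context: An Artin–Tits system $\Gamma=((V,E),m)$ consists of a simplicial graph $(V,E)$ and a labelling $m\colon E\to\{2,3,\dots\}$; the Artin–Tits group is $G_\Gamma=\langle V \mid \mathrm{prod}(u,v,m(\{u,v\}))=\mathrm{prod}(v,u,m(\{u,v\}))\ \forall \{u,v\}\in E\rangle$, where $\mathrm{prod}(u,v,n)$ is the prefix of length $n$ of $uvuv\cdots$. An EAFC system is one with all labels even and such that among any three pairwise adjacent vertices at least two of the three edges have label $2$. For $S\subseteq V$, $G_S=\langle S\rangle\leqslant G_\Gamma$ is a standard parabolic subgroup; a parabolic subgroup is a conjugate $gG_Sg^{-1}$ of a standard parabolic subgroup. For $Y\subseteq G_\Gamma$, the parabolic closure $P(Y)$ is the intersection of all parabolic subgroups of $G_\Gamma$ containing $Y$; for $g\in G_\Gamma$, $P(g)=P(\{g\})$. (For finite EAFC systems an intersection of parabolic subgroups is again parabolic, so $P(Y)$ is parabolic.) *)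

(* Defs.v *)
From mathcomp Require Import all_boot all_order all_algebra.
Set Implicit Arguments. Unset Strict Implicit. Unset Printing Implicit Defensive.

(* An Artin–Tits system on a finite vertex type V: a simplicial graph
   (symmetric irreflexive adjacency) with labels >= 2 on edges.
   The label function is only meaningful on edges. *)
Record ATsystem (V : finType) := {
  adj : rel V;
  adj_sym : forall u v, adj u v = adj v u;
  adj_irr : forall u, ~~ adj u u;
  lab : V -> V -> nat;
  lab_sym : forall u v, adj u v -> lab u v = lab v u;
  lab_ge2 : forall u v, adj u v -> 2 <= lab u v }.

Definition EAFC (V : finType) (G : ATsystem V) : Prop :=
  (forall u v, adj G u v -> ~~ odd (lab G u v)) /\
  (forall u v w, adj G u v -> adj G v w -> adj G u w ->
     2 <= (lab G u v == 2) + (lab G v w == 2) + (lab G u w == 2)).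

(* Words in the generators and their inverses: (true, x) = x, (false, x) = x^-1. *)
Definition word (V : finType) := seq (bool * V).

Definition prodw (V : finType) (u v : V) (n : nat) : word V :=
  mkseq (fun i => (true, if odd i then v else u)) n.

Inductive aeq (V : finType) (G : ATsystem V) : word V -> word V -> Prop :=
| aeq_refl w : aeq G w w
| aeq_sym w1 w2 : aeq G w1 w2 -> aeq G w2 w1
| aeq_trans w1 w2 w3 : aeq G w1 w2 -> aeq G w2 w3 -> aeq G w1 w3
| aeq_free (p q : word V) (b : bool) (x : V) :
    aeq G (p ++ (b, x) :: (~~ b, x) :: q) (p ++ q)
| aeq_rel (p q : word V) (u v : V) : adj G u v ->
    aeq G (p ++ prodw u v (lab G u v) ++ q) (p ++ prodw v u (lab G u v) ++ q).

Definition winv (V : finType) (w : word V) : word V :=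
  rev (map (fun l : bool * V => (~~ l.1, l.2)) w).

Definition wpow (V : finType) (w : word V) (n : int) : word V :=
  match n with
  | Posz k => flatten (nseq k w)
  | Negz k => flatten (nseq k.+1 (winv w))
  end.

(* Subsets of G_Gamma are represented as predicates on words (closed under aeq
   in all cases below). *)
Definition std_parabolic (V : finType) (G : ATsystem V) (S : {set V}) (w : word V) : Prop :=
  exists u : word V, all (fun l : bool * V => l.2 \in S) u /\ aeq G w u.

Definition is_parabolic (V : finType) (G : ATsystem V) (Q : word V -> Prop) : Prop :=
  exists (h : word V) (S : {set V}), forall w,
    Q w <-> exists u, std_parabolic G S u /\ aeq G w (h ++ u ++ winv h).

Definition pclosure (V : finType) (G : ATsystem V) (Y : word V -> Prop) (w : word V) : Prop :=
  forall Q : word V -> Prop, is_parabolic G Q -> (forall y, Y y -> Q y) -> Q w.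

(* Main.v *)
Require Import Defs.
From mathcomp Require Import all_boot all_order all_algebra.
From mathcomp Require Import zify boolp.
From HB Require Import structures.
Set Implicit Arguments. Unset Strict Implicit. Unset Printing Implicit Defensive.
Import GRing.Theory.
Local Open Scope group_scope.

(* As a parabolic subgroup is conjugate to a standard one, it suffices to prove
   that every standard parabolic subgroup G_S is closed under roots; by induction
   on the vertex set W one may take S = W - v.

   If v is not adjacent to all of W, then G_W is the amalgam of G_(W - v) and
   G_(star v) over G_(link v), and the claim follows from the behaviour of powers
   of reduced words, the link being closed under roots in both factors. If v is
   central in G_W, it follows from the degree in v. Otherwise some u has a label
   m(u,v) > 2; split G_W over the link of u instead. By the EAFC condition
   G_(star u) is the direct product of the dihedral group on {u, v} and of
   G_(link u - v), and if g^n avoids v then comparing the normal forms of g and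
   g^n determines g up to a power of v, which vanishes for degree reasons. *)

(** * Normal forms in amalgamated products *)

(** Nothing is glued abstractly: an amalgam is given by subsets of the group at hand, and its normal
    form theorem comes from letting the generators act on candidate normal forms. Once the defining
    relations are checked for this action, the image of the empty sequence under [g] is the normal
    form of [g]. Even labels provide the other tools: a retraction onto each $G_S$, so that
    membership is a fixed-point equation and coset representatives over a link come for free, and
    the exponent sum in each vertex. If [v] is adjacent to the rest of [W], its star is [W] and the
    splitting over its link says nothing. The star of [u] may be all of [W] too, so induction does
    not make the link of [u] closed under roots in it; the dihedral group has to supply this,
    through a splitting of its own. And [par (W :\ v)] is not a factor of the splitting at [u], so
    that membership in it has to be read off normal forms. *)

Section GroupClosed.
Variables (G : groupType) (S : {pred G}).
Hypothesis gS : group_closed S.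

Lemma closed1 : 1 \in S. Proof. by case: gS. Qed.
Lemma closedM : {in S &, forall x y, x * y \in S}.
Proof. by move=> x y; exact: (group_closedM gS). Qed.
Lemma closedV : {in S, forall x, x^-1 \in S}.
Proof. exact: group_closedV. Qed.
Lemma closedX n : {in S, forall x, x ^+ n \in S}.
Proof.
move=> x Sx; elim: n => [|n IH]; first exact: closed1.
by rewrite expgS closedM.
Qed.
Lemma closedMl x y : x \in S -> (y * x \in S) = (y \in S).
Proof.
move=> Sx; apply/idP/idP => [Syx|Sy]; last exact: closedM.
by rewrite -(mulgK x y) closedM ?closedV.
Qed.
End GroupClosed.

Lemma conj_eq1 (G : groupType) (e n : G) : (e * n * e^-1 == 1) = (n == 1).
Proof. by have := conjg_eq1 n e^-1; rewrite conjgE invgK mulgA. Qed.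

(* Two subgroups [factor true], [factor false] with a common subgroup [edge].
   [rep t] picks representatives of the cosets [a * edge] in [factor t], and
   [repMl] says that conjugation by [edge] preserves this transversal: this is
   what lets [edge] act on normal forms syllable by syllable. *)
Record amalgam (G : groupType) := Amalgam {
  factor : bool -> {pred G};
  edge : {pred G};
  rep : bool -> G -> G;
  factor_closed : forall t, group_closed (factor t);
  edge_closed : group_closed edge;
  sub_edge : forall t, {subset edge <= factor t};
  rep_coset : forall t, {in factor t, forall a, (rep t a)^-1 * a \in edge};
  repMr : forall t, {in factor t & edge, forall a e, rep t (a * e) = rep t a};
  repMl : forall t,
    {in factor t & edge, forall a e, rep t (e * a) = e * rep t a * e^-1};
  rep1 : forall t, rep t 1 = 1 }.

Section Syllables.
Variables (G : groupType) (D : amalgam G).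
Local Notation H := (factor D).
Local Notation E := (edge D).
Local Notation rep := (rep D).
Let gH := @factor_closed G D.
Let gE := @edge_closed G D.
Let sEH := @sub_edge G D.

Lemma rep_in t a : a \in H t -> rep t a \in H t.
Proof.
move=> Ha; have /(sEH t) := rep_coset Ha.
by rewrite (closedMl (gH t)) // => /(closedV (gH t)); rewrite invgK.
Qed.

Lemma repE t e : e \in E -> rep t e = 1.
Proof. by move=> Ee; rewrite -[e]mul1g repMr ?rep1 // closed1. Qed.

Lemma rep_eq1 t a : a \in H t -> (rep t a == 1) = (a \in E).
Proof.
move=> Ha; apply/eqP/idP => [ra|/repE //].
by have := rep_coset Ha; rewrite ra invg1 mul1g.
Qed.

Lemma rep_split t a : a \in H t -> exists2 e, e \in E & a = rep t a * e.
Proof.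
by move=> Ha; exists ((rep t a)^-1 * a); [exact: rep_coset | rewrite mulVKg].
Qed.

Lemma rep_id t a : a \in H t -> rep t (rep t a) = rep t a.
Proof.
move=> Ha; have [e Ee ae] := rep_split Ha.
by rewrite {2}ae repMr // rep_in.
Qed.

Lemma repMrep t a b : a \in H t -> b \in H t -> rep t (a * rep t b) = rep t (a * b).
Proof.
move=> Ha Hb; have [e Ee be] := rep_split Hb.
by rewrite [in RHS]be mulgA [RHS]repMr // (closedM (gH t)) ?rep_in.
Qed.

Definition starts (t : bool) (s : seq (bool * G)) :=
  if s is (t', _) :: _ then t' == t else false.

Fixpoint normal (s : seq (bool * G)) :=
  if s is (t, n) :: s' then
    [&& n \in H t, rep t n == n, n != 1, ~~ starts t s' & normal s']
  else true.

(** If the leading syllable lies in the other factor, the trivial syllable 1 is popped; [push]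
    discards it again, so [push] undoes [pop] in every case. *)
Definition pop t (s : seq (bool * G)) :=
  if s is (t', n) :: s' then if t' == t then (n, s') else (1, s)
  else (1, [::]).

Definition push t n (s : seq (bool * G)) := if n == 1 then s else (t, n) :: s.

(** Moving [e] from the left of a product to its right conjugates every syllable; at the right end
    [e] disappears into the coset of [edge]. *)
Definition conjs e (s : seq (bool * G)) :=
  [seq (x.1, e * x.2 * e^-1) | x <- s].

(* The action of [factor t] on the normal forms of the cosets of [edge] in the
   amalgamated product. *)
Definition act t a s :=
  let an := a * (pop t s).1 in
  let m := rep t an in push t m (conjs (m^-1 * an) (pop t s).2).

Definition sprod (s : seq (bool * G)) := foldr (fun x g => x.2 * g) 1 s.

Lemma starts_conjs t e s : starts t (conjs e s) = starts t s.
Proof. by case: s => [|[t' n] s]. Qed.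

Lemma conjs1 s : conjs 1 s = s.
Proof.
by rewrite /conjs -[RHS]map_id; apply: eq_map => -[t n] /=; rewrite mul1g invg1 mulg1.
Qed.

Lemma conjsM d e s : conjs (d * e) s = conjs d (conjs e s).
Proof.
by rewrite /conjs -map_comp; apply: eq_map => -[t n] /=; rewrite invgM !mulgA.
Qed.


Lemma normal_conjs e s : e \in E -> normal s -> normal (conjs e s).
Proof.
move=> Ee; have EVe := closedV gE Ee.
elim: s => //= -[t n] s IH /and5P[Hn /eqP rn n1 st /IH ->] /=.
have He := sEH t Ee; have HVe := sEH t EVe.
have Hne : n * e^-1 \in H t by rewrite (closedM (gH t)).
have -> : e * n * e^-1 \in H t by rewrite -mulgA (closedM (gH t)).
by rewrite starts_conjs st conj_eq1 n1 -mulgA repMl // repMr // rn mulgA eqxx.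
Qed.

Lemma popP t s : normal s ->
  [/\ (pop t s).1 \in H t, rep t (pop t s).1 = (pop t s).1,
      normal (pop t s).2, ~~ starts t (pop t s).2
    & push t (pop t s).1 (pop t s).2 = s].
Proof.
have H1 := closed1 (gH t).
case: s => [|[t' n] s] /=; first by rewrite rep1 /push eqxx.
move=> /and5P[Hn /eqP rn n1 st ns]; case: eqP => [tt'|/eqP ntt'] /=.
  by subst t'; rewrite /push (negPf n1).
by rewrite rep1 /push eqxx ntt' Hn rn n1 st ns eqxx.
Qed.

Lemma pop_push t n s : ~~ starts t s -> pop t (push t n s) = (n, s).
Proof.
rewrite /push; case: eqP => [->|_] /=; last by rewrite eqxx.
by case: s => //= -[t' m] s /= /negPf->.
Qed.

Lemma normal_push t n s : n \in H t -> rep t n = n -> normal s ->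
  ~~ starts t s -> normal (push t n s).
Proof.
by move=> Hn rn ns st; rewrite /push; case: ifPn => //= ->; rewrite Hn rn eqxx st.
Qed.

Lemma normal_act t a s : a \in H t -> normal s -> normal (act t a s).
Proof.
move=> Ha /(popP t)[Hp rp np sp _].
have Hap : a * (pop t s).1 \in H t by rewrite (closedM (gH t)).
apply: normal_push; rewrite ?starts_conjs ?rep_id ?rep_in //.
by apply: normal_conjs; rewrite ?rep_coset.
Qed.

(** The edge parts split off by the two successive actions multiply to the edge part split off by
    [a * b], and the tail is conjugated by this product either way. *)
Lemma actM t a b s : a \in H t -> b \in H t -> normal s ->
  act t (a * b) s = act t a (act t b s).
Proof.
move=> Ha Hb /(popP t)[Hp rp np sp _].
have Hbp : b * (pop t s).1 \in H t by rewrite (closedM (gH t)).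
rewrite {3}/act {2}/act pop_push ?starts_conjs //= repMrep // -conjsM !mulgA.
by rewrite /act ?gnorm.
Qed.

(** The result does not depend on [t]: the actions of the two factors agree on the edge group, so
    they can be glued. *)
Lemma actE t e s : e \in E -> normal s -> act t e s = conjs e s.
Proof.
move=> Ee /(popP t)[Hp rp np sp ss].
rewrite /act repMl // rp -[in RHS]ss /push conj_eq1.
have ->: (e * (pop t s).1 * e^-1)^-1 * (e * (pop t s).1) = e by rewrite ?gnorm.
by case: ifP.
Qed.

Lemma act1 t s : normal s -> act t 1 s = s.
Proof. by move=> ns; rewrite actE ?conjs1 // closed1. Qed.

Lemma actK t a b s : a \in H t -> b \in H t -> a * b = 1 -> normal s ->
  act t a (act t b s) = s.
Proof. by move=> Ha Hb ab1 ns; rewrite -actM // ab1 act1. Qed.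

Lemma iter_act2 t a b k s : a \in H t -> b \in H t -> normal s ->
  iter k (fun s => act t a (act t b s)) s = act t ((a * b) ^+ k) s.
Proof.
move=> Ha Hb ns; have Hab : a * b \in H t by rewrite (closedM (gH t)).
elim: k => [|k IH]; first by rewrite expg0 act1.
have Habk : (a * b) ^+ k \in H t by rewrite (closedX (gH t)).
by rewrite iterS IH -actM ?normal_act // -actM ?expgS.
Qed.

Lemma all_act (S : {pred G}) t a s : group_closed S ->
  (forall t, {in S, forall b, rep t b \in S}) -> a \in S ->
  all [pred x | x.2 \in S] s -> all [pred x | x.2 \in S] (act t a s).
Proof.
move=> gS Srep Sa Ss.
have [Sp Sp2] : (pop t s).1 \in S /\ all [pred x | x.2 \in S] (pop t s).2.
  case: s Ss => [|[t' n] s] /=; first by rewrite (closed1 gS).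
  by case/andP=> Sn Ss; case: ifP => _ /=; rewrite ?Sn ?(closed1 gS).
have Sm : rep t (a * (pop t s).1) \in S by rewrite Srep ?(closedM gS).
have Sc : all [pred x | x.2 \in S] (conjs ((rep t (a * (pop t s).1))^-1 *
    (a * (pop t s).1)) (pop t s).2).
  apply/allP=> _ /mapP[x xs ->] /=.
  have Sx := allP Sp2 _ xs.
  by rewrite !(closedM gS) ?(closedV gS) ?(closedM gS) ?(closedV gS).
by rewrite /act /push; case: ifP => //= _; rewrite Sm.
Qed.

Lemma size_act t a s : size (act t a s) <= (size s).+1.
Proof.
rewrite /act /push; case: ifP => _ /=; rewrite size_map.
  by case: s => [|[t' n] s] //=; case: eqP => //= _; rewrite ltnW.
by case: s => [|[t' n] s] //=; case: eqP.
Qed.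

Lemma sprod_conjs e s : sprod (conjs e s) = e * sprod s * e^-1.
Proof. by elim: s => [|x s IH] /=; rewrite ?IH ?gnorm. Qed.

Lemma sprod_push t n s : sprod (push t n s) = n * sprod s.
Proof. by rewrite /push; case: eqP => [->|] //=; rewrite mul1g. Qed.

(** [sprod] turns the action into left multiplication on the cosets of [edge]; letter by letter this
    gives [nf_coset]. *)
Lemma sprod_act t a s : a \in H t -> normal s ->
  (sprod (act t a s))^-1 * a * sprod s \in E.
Proof.
move=> Ha /(popP t)[Hp _ _ _ ss].
have Hap : a * (pop t s).1 \in H t by rewrite (closedM (gH t)).
rewrite sprod_push sprod_conjs -[in sprod s]ss sprod_push.
by have := rep_coset Hap; rewrite ?gnorm.
Qed.


(** * Reduced words and their powers *)

Fixpoint alternating (t : bool) (l : seq G) :=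
  if l is s :: l' then [&& s \in H t, s \notin E & alternating (~~ t) l']
  else true.

Definition gprod (l : seq G) := foldr (fun x y => x * y) 1 l.

Lemma gprod_cat l1 l2 : gprod (l1 ++ l2) = gprod l1 * gprod l2.
Proof. by elim: l1 => [|s l1 IH] /=; rewrite ?mul1g // IH mulgA. Qed.

Lemma gprod_rcons l s : gprod (rcons l s) = gprod l * s.
Proof. by rewrite -cats1 gprod_cat /= mulg1. Qed.

Lemma gprod_nseq n l : gprod (flatten (nseq n l)) = gprod l ^+ n.
Proof. by elim: n => //= n IH; rewrite gprod_cat IH expgS. Qed.

Lemma alternating_cat t l1 l2 : alternating t (l1 ++ l2) =
  alternating t l1 && alternating (t (+) odd (size l1)) l2.
Proof.
elim: l1 t => [|s l1 IH] t /=; first by rewrite addbF.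
by rewrite IH -!andbA addbN addNb.
Qed.

Lemma alternating_rcons t l s : alternating t (rcons l s) =
  [&& alternating t l, s \in H (t (+) odd (size l)) & s \notin E].
Proof. by rewrite -cats1 alternating_cat /= andbT. Qed.

Lemma alternating_nseq t n l : alternating t l -> ~~ odd (size l) ->
  alternating t (flatten (nseq n l)).
Proof.
move=> al /negPf ol; elim: n => //= n IH.
by rewrite alternating_cat al ol addbF.
Qed.

Lemma alternating_normal s : normal s -> s != [::] ->
  exists2 t, starts t s & alternating t (unzip2 s).
Proof.
elim: s => //= -[t n] s IH /and5P[Hn /eqP rn n1 st ns] _; exists t => //=.
rewrite Hn -(rep_eq1 Hn) rn n1 /=.
case: s IH st ns => //= x s IH st ns; have [t' st' al] := IH ns isT.
suff -> : ~~ t = t' by [].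
by case: x {IH ns al} st st' => t'' n' /=; move: (t) (t') t'' => [] [] [].
Qed.

(* The edge element is absorbed by the last syllable. *)
Lemma alternating_of_normal s e : normal s -> s != [::] -> e \in E ->
  exists t l, [/\ starts t s, alternating t l, gprod l = sprod s * e
                & size l = size s].
Proof.
move=> ns s0 Ee; have [t st al] := alternating_normal ns s0.
have Es : gprod (unzip2 s) = sprod s by elim: (s) => //= x s' ->.
have Zs : size (unzip2 s) = size s by rewrite size_map.
have: unzip2 s != [::] by rewrite -size_eq0 Zs size_eq0.
case/lastP: (unzip2 s) al Es Zs => // l x.
rewrite alternating_rcons => /and3P[al Hx nEx] Es Zs _.
exists t, (rcons l (x * e)); split => //; last by rewrite -Zs !size_rcons.
  by rewrite alternating_rcons al (closedM (gH _)) ?(sEH _ Ee) // (closedMl gE).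
by rewrite -Es !gprod_rcons mulgA.
Qed.

(* For dihedral groups the edge group is not closed under roots in the factors;
   it is so among the elements of degree 0, hence the predicate [P]. *)
Section PowerWord.
Variable P : pred G.
Hypothesis PJ : forall x y, P (x * y * x^-1) = P y.
Hypothesis Pfree : forall t n, {in H t, forall s, P s -> s \notin E ->
  0 < n -> s ^+ n \notin E}.

Lemma conjg_expg (x y : G) n : (x * y * x^-1) ^+ n = x * y ^+ n * x^-1.
Proof. by have := conjXg y x^-1 n; rewrite !conjgE !invgK !mulgA => ->. Qed.

(* In the Bass-Serre tree: an element spelled by an odd word is either elliptic,
   conjugate to a one-syllable word, or it is hyperbolic with an axis missing
   the base edge. Either way its powers still start with the same syllable. *)
Lemma odd_word_power t l n : alternating t l -> odd (size l) -> P (gprod l) ->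
  0 < n -> exists l', [/\ alternating t l', gprod l' = gprod l ^+ n,
    odd (size l') & 2 < size l -> 2 < size l' /\ head 1 l' = head 1 l].
Proof.
elim: {l}(size l) {-2}l (leqnn (size l)) t => [|k IH] l.
  by rewrite leqn0 size_eq0 => /eqP->.
case: l => // s l /= + t /and3P[Hs nEs al].
case/lastP: l al => [|m s'] al lk ol Pl n0.
  exists [:: s ^+ n]; rewrite /= !mulg1 in Pl *.
  by rewrite (closedX (gH t)) // (Pfree Hs).
move: al; rewrite alternating_rcons => /and3P[am Hs' nEs'].
have om : odd (size m) by move: ol; rewrite size_rcons /= negbK.
rewrite om addbT negbK in Hs'.
have m2 : 2 < (size (rcons m s')).+1 by rewrite size_rcons; case: (m) om.
rewrite gprod_rcons mulgA in Pl *.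
have Hss : s' * s \in H t by rewrite (closedM (gH t)).
(* The word is [s], [m], [s'] with both ends in the same factor. If [s' * s] is an edge element,
   conjugating by [s] absorbs it into the last syllable of [m] and leaves an odd word shorter by
   two. *)
have [Ess|nEss] := boolP (s' * s \in E).
  case/lastP: m {ol} am om lk Pl m2 => // m q; rewrite alternating_rcons !size_rcons /=.
  move=> /and3P[am Hq nEq] om lk Pl _.
  pose m' := rcons m (q * (s' * s)).
  have Em' : s * gprod (rcons m q) * s' = s * gprod m' * s^-1.
    by rewrite !gprod_rcons ?gnorm.
  have am' : alternating (~~ t) m'.
    rewrite alternating_rcons am (closedM (gH _)) ?(sub_edge _ Ess) //.
    by rewrite (closedMl gE).
  rewrite Em' PJ in Pl *.
  have [||l' [al' El' ol' _]] := IH m' _ (~~ t) am' _ Pl n0.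
  - by rewrite size_rcons; lia.
  - by rewrite size_rcons.
  exists (s :: rcons l' s^-1); split=> /=.
  - rewrite Hs nEs alternating_rcons al' ol' addbT negbK (closedV (gH t)) //=.
    by apply: contra nEs => /(closedV gE); rewrite invgK.
  - by rewrite gprod_rcons El' conjg_expg mulgA.
  - by rewrite size_rcons /= negbK.
  - by rewrite size_rcons; split=> //; case: (l') ol'.
pose x := rcons m (s' * s).
have ax : alternating (~~ t) x by rewrite alternating_rcons am om addbT negbK Hss.
have ox : ~~ odd (size x) by rewrite size_rcons /= om.
(* The power is [s * gprod x ^+ n * s^-1], where [x] is cyclically reduced; the final [s^-1] turns
   the last syllable [s' * s] into [s']. *)
exists (s :: flatten (nseq n.-1 x) ++ rcons m s'); split=> /=.
- rewrite Hs nEs alternating_cat alternating_nseq //=.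
  have -> : odd (size (flatten (nseq n.-1 x))) = false.
    elim: (n.-1) => //= i; rewrite size_cat oddD => ->.
    by rewrite (negPf ox).
  by rewrite addbF alternating_rcons am om addbT negbK Hs'.
- have -> : s * gprod m * s' = s * gprod x * s^-1 by rewrite gprod_rcons ?gnorm.
  rewrite conjg_expg -[in RHS](prednK n0) expgSr gprod_cat gprod_nseq.
  by rewrite !gprod_rcons ?gnorm.
- rewrite size_cat oddD size_rcons /= om.
  elim: (n.-1) => //= i; rewrite size_cat oddD => IHi.
  by rewrite -[odd (size x)]negbK ox /=.
- by rewrite size_cat size_rcons; split=> //; case: (m) om => //=; lia.
Qed.
End PowerWord.

(** [L] is defined on the whole group, but letters outside the subgroup [K] will act trivially;
    hence [nf_coset] recovers [g] up to [edge] only for [g] in [K]. *)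
Record normal_form (K : {pred G}) (L : G -> seq (bool * G)) : Prop := NormalForm {
  nf1 : L 1 = [::];
  nfM : forall t, {in H t, forall a g, L (a * g) = act t a (L g)};
  nf_normal : forall g, normal (L g);
  nf_coset : {in K, forall g, (sprod (L g))^-1 * g \in E} }.

(** * Lengths of powers, and roots of elements of a factor *)

Section NormalForm.
Variables (K : {pred G}) (L : G -> seq (bool * G)).
Hypothesis nfL : normal_form K L.

(** The normal form of the rest starts in the other factor, so nothing merges with [a], and [a]
    outside [edge] has a nontrivial representative. *)
Lemma nf_alternating_cons t a l : alternating t (a :: l) ->
  L (gprod (a :: l)) = (t, rep t a) :: conjs ((rep t a)^-1 * a) (L (gprod l)).
Proof.
elim: l a t => [|b l IH] a t /= /and3P[Ha nEa al].
  rewrite (nfM nfL Ha) (nf1 nfL) /act /= !mulg1.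
  by rewrite /push (rep_eq1 Ha) (negPf nEa).
rewrite (nfM nfL Ha) (IH _ _ al) /act /=.
have -> : (~~ t == t) = false by case: (t).
by rewrite /= !mulg1 /push (rep_eq1 Ha) (negPf nEa).
Qed.

Lemma size_nf_alternating t l : alternating t l -> size (L (gprod l)) = size l.
Proof.
elim: l t => [|a l IH] t al; first by rewrite (nf1 nfL).
rewrite (nf_alternating_cons al) /= size_map.
by case/and3P: al => _ _ /IH ->.
Qed.

(** Edge parts only travel to the right, so later syllables do not affect the normal form of a
    prefix. *)
Lemma nf_alternating_cat t l1 l2 : alternating t (l1 ++ l2) ->
  exists y, L (gprod (l1 ++ l2)) = L (gprod l1) ++ y.
Proof.
elim: l1 t => [|a l1 IH] t al; first by rewrite (nf1 nfL); eexists.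
have al1 : alternating t (a :: l1).
  by move: al; rewrite alternating_cat => /andP[].
have [y Ey] : exists y, L (gprod (l1 ++ l2)) = L (gprod l1) ++ y.
  by case/and3P: al => _ _; apply: IH.
exists (conjs ((rep t a)^-1 * a) y).
by rewrite cat_cons !(@nf_alternating_cons t) // Ey /conjs map_cat.
Qed.

Lemma nf_word g : g \in K -> L g != [::] ->
  exists t l, [/\ starts t (L g), alternating t l, gprod l = g
                & size l = size (L g)].
Proof.
move=> Kg g0; have ng := nf_normal nfL g; have cg := nf_coset nfL Kg.
have [t [l [st al El Zl]]] := alternating_of_normal ng g0 cg.
by exists t, l; rewrite El mulVKg.
Qed.

Lemma nf_nil g : g \in K -> (L g == [::]) = (g \in E).
Proof.
move=> Kg; apply/eqP/idP => [g0|Eg].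
  by have := nf_coset nfL Kg; rewrite g0 /= invg1 mul1g.
have Hg := sEH true Eg.
rewrite -[g]mulg1 (nfM nfL Hg) (nf1 nfL) /act /= !mulg1.
by rewrite /push (repE true Eg) eqxx.
Qed.

Lemma nf_factor g : g \in K -> size (L g) <= 1 -> exists t, g \in H t.
Proof.
move=> Kg; have [/eqP|g0] := eqVneq (L g) [::].
  by rewrite nf_nil // => Eg _; exists true; apply: sEH.
have [t [l [_ al <- <-]]] := nf_word Kg g0.
case: l al => [|a [|b l]] //= => [_|/andP[Ha _]] _; exists t.
  exact: closed1 (gH t).
by rewrite mulg1.
Qed.

Lemma size_nf_factor t g : g \in H t -> size (L g) <= 1.
Proof.
by move=> Hg; rewrite -[g]mulg1 (nfM nfL Hg) (nf1 nfL); apply: size_act.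
Qed.

(** A reduced word of even length begins and ends in different factors, so copies of it can be
    concatenated without reduction. *)
Lemma nf_power_even g n : g \in K -> 0 < n -> ~~ odd (size (L g)) ->
  exists y, L (g ^+ n) = L g ++ y.
Proof.
move=> Kg n0; have [->|g0] := eqVneq (L g) [::]; first by eexists.
have [t [l [_ al <- <-]]] := nf_word Kg g0 => ol.
rewrite -gprod_nseq -(prednK n0) /=; apply: (@nf_alternating_cat t).
by rewrite alternating_cat al (negPf ol) addbF alternating_nseq.
Qed.

Lemma size_nf_gprod l :
  {in l, forall a, exists t, a \in H t} -> size (L (gprod l)) <= size l.
Proof.
elim: l => [|a l IH] Hl; first by rewrite (nf1 nfL).
have [t Ha] := Hl a (mem_head _ _).
rewrite /= (nfM nfL Ha); apply: leq_trans (size_act _ _ _) _.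
by apply: IH => b lb; apply: Hl; rewrite inE lb orbT.
Qed.

Lemma alternating_in t l : alternating t l ->
  {in l, forall a, exists t, a \in H t}.
Proof.
elim: l t => //= a l IH t /and3P[Ha _ /IH al] b.
by rewrite inE => /predU1P[->|/al //]; exists t.
Qed.

(** In odd length the first and last syllables lie in the same factor. Conjugating by [m] reduces
    the first one to an edge element, absorbed by the second, while [m] merges into the last. *)
Lemma size_nf_conj g t m s : g \in K -> L g = (t, m) :: s ->
  odd (size (L g)) -> s != [::] -> size (L (m^-1 * g * m)) < size (L g).
Proof.
move=> Kg Lg og s0; have g0 : L g != [::] by rewrite Lg.
have Hm : m \in H t by have := nf_normal nfL g; rewrite Lg => /and5P[].
have [t' [l [_ al El Zl]]] := nf_word Kg g0.
case: l al El Zl => [|a l] al El Zl; first by move: Zl; rewrite Lg.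
have [tt' ma] : t = t' /\ m = rep t' a.
  by move: Lg; rewrite -El (nf_alternating_cons al) => -[-> ->].
subst t'; rewrite -Zl -El /= in og *.
move: al => /= /and3P[Ha _ al].
have Ema : m^-1 * a \in E by rewrite ma rep_coset.
have: l != [::].
  by move: Zl s0; rewrite Lg -!size_eq0 /= => -[->].
case: l {El Zl} al og => // b l al og _.
case/lastP: l al og => [|l c]; first by case/and3P.
rewrite -rcons_cons alternating_rcons size_rcons.
move=> /and3P[/and3P[Hb _ al] Hc _] og; rewrite rcons_cons.
have -> : m^-1 * (a * (b * gprod (rcons l c))) * m =
    gprod (m^-1 * a * b :: rcons l (c * m)).
  by rewrite /= !gprod_rcons ?gnorm.
apply: leq_trans (size_nf_gprod _) _; last by rewrite /= !size_rcons.
move=> x; rewrite inE mem_rcons inE => /or3P[/eqP->|/eqP->|lx].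
- by exists (~~ t); rewrite (closedM (gH _)) ?(sEH _ Ema).
- exists t; rewrite (closedM (gH t)) //.
  by move: Hc og; rewrite /= !negbK => + og; rewrite og addbT negbK.
exact: alternating_in al _ lx.
Qed.

Variable P : pred G.
Hypothesis PJ : forall x y, P (x * y * x^-1) = P y.
Hypothesis Pfree : forall t n, {in H t, forall s, P s -> s \notin E ->
  0 < n -> s ^+ n \notin E}.

Lemma nf_power g n : g \in K -> P g -> 0 < n -> 1 < size (L g) ->
  1 < size (L (g ^+ n)) /\ ohead (L (g ^+ n)) = ohead (L g).
Proof.
move=> Kg Pg n0 g1.
have [/negPf og|og] := boolP (~~ odd (size (L g))).
  have [|y ->] := nf_power_even Kg n0; first by rewrite og.
  by case: (L g) g1 => // a s; rewrite size_cat /= => ?; split=> //; lia.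
rewrite negbK in og.
have g0 : L g != [::] by rewrite -size_eq0; case: (size _) g1.
have [t [l [_ al El Zl]]] := nf_word Kg g0.
rewrite -Zl -El in og g1 Pg *.
have [l' [al' El' ol' hl']] := odd_word_power PJ Pfree al og Pg n0.
have l2 : 2 < size l by case: (size l) og g1 => [|[|[]]].
have [l'2 hd] := hl' l2; rewrite -El' !(size_nf_alternating al') //.
split; first by rewrite ltnW.
case: l l' al al' l2 l'2 hd {El Zl og g1 Pg El' ol' hl'}
  => [|a l] [|b l'] // al al' _ _ hd.
have {hd} Eab : b = a := hd.
by rewrite (nf_alternating_cons al) (nf_alternating_cons al') Eab.
Qed.

(** By [nf_power] the element [g] has length at most 1, so it lies in some factor. If this is the
    other one and [g] is not in [edge], then [g ^+ n] would have two one-syllable normal forms with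
    different labels. *)
Lemma factor_root_closed t g n : g \in K -> P g -> 0 < n -> g ^+ n \in H t ->
  g \in H t.
Proof.
move=> Kg Pg n0 Hgn.
have [g1|g1] := leqP (size (L g)) 1; last first.
  have [+ _] := nf_power Kg Pg n0 g1.
  by rewrite ltnNge (size_nf_factor Hgn).
have [t' Hg] := nf_factor Kg g1.
have [<-//|tt'] := eqVneq t' t.
have [Eg|nEg] := boolP (g \in E); first exact: sEH.
have nEgn : g ^+ n \notin E by apply: Pfree Hg _ _ _.
have Hgn' : g ^+ n \in H t' by rewrite (closedX (gH t')).
have := @nf_alternating_cons t' (g ^+ n) [::].
have := @nf_alternating_cons t (g ^+ n) [::].
by rewrite /= Hgn Hgn' nEgn => ->// /(_ isT)[] E'; rewrite E' eqxx in tt'.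
Qed.

End NormalForm.

End Syllables.

(** * Artin-Tits groups *)

Section ArtinGroup.
Variables (V : finType) (G : ATsystem V).

Lemma aeq_cat2l w w1 w2 : aeq G w1 w2 -> aeq G (w ++ w1) (w ++ w2).
Proof.
elim=> [w0|u1 u2 _ IH|u1 u2 u3 _ IH1 _ IH2|p q b x|p q u v uv].
- exact: aeq_refl.
- exact: aeq_sym.
- exact: aeq_trans IH1 IH2.
- by rewrite !catA; apply: aeq_free.
- by rewrite (catA w p) (catA w p); apply: aeq_rel.
Qed.

Lemma aeq_cat2r w w1 w2 : aeq G w1 w2 -> aeq G (w1 ++ w) (w2 ++ w).
Proof.
elim=> [w0|u1 u2 _ IH|u1 u2 u3 _ IH1 _ IH2|p q b x|p q u v uv].
- exact: aeq_refl.
- exact: aeq_sym.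
- exact: aeq_trans IH1 IH2.
- by rewrite -!catA; apply: aeq_free.
- by rewrite -!catA; apply: aeq_rel.
Qed.

Lemma aeq_cat w1 w2 w3 w4 :
  aeq G w1 w2 -> aeq G w3 w4 -> aeq G (w1 ++ w3) (w2 ++ w4).
Proof. by move=> /(aeq_cat2r w3) + /(aeq_cat2l w2); apply: aeq_trans. Qed.

Lemma winvK : involutive (@winv V).
Proof.
move=> w; rewrite /winv map_rev revK -map_comp -[RHS]map_id.
by apply: eq_map => -[b x] /=; rewrite negbK.
Qed.

Lemma winv_cons l (w : word V) : winv (l :: w) = winv w ++ [:: (~~ l.1, l.2)].
Proof. by rewrite /winv /= rev_cons cats1. Qed.

Lemma aeq_winvr w : aeq G (w ++ winv w) [::].
Proof.
elim: w => [|[b x] w IH]; first exact: aeq_refl.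
rewrite winv_cons /= catA -cat1s.
apply: aeq_trans (aeq_cat2l [:: (b, x)] (aeq_cat2r _ IH)) _.
exact: (aeq_free G [::] [::] b x).
Qed.

Lemma aeq_winvl w : aeq G (winv w ++ w) [::].
Proof. by have := aeq_winvr (winv w); rewrite winvK. Qed.

Lemma aeq_winv w1 w2 : aeq G w1 w2 -> aeq G (winv w1) (winv w2).
Proof.
move=> e12; have := aeq_cat2l (winv w1) (aeq_winvr w2).
rewrite cats0 => /aeq_sym e1; apply: aeq_trans e1 _; rewrite catA.
apply: (aeq_cat2r (winv w2) (w2 := [::])).
exact: aeq_trans (aeq_cat2l _ (aeq_sym e12)) (aeq_winvl _).
Qed.

Definition aeqb (w1 w2 : word V) := `[< aeq G w1 w2 >].

Lemma aeqb_equiv : equiv_class_of aeqb.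
Proof.
split=> [w|w1 w2|w2 w1 w3].
- by apply/asboolP; apply: aeq_refl.
- by apply/asboolP/asboolP; apply: aeq_sym.
- by move=> /asboolP e12 /asboolP e23; apply/asboolP; apply: aeq_trans e12 e23.
Qed.

Canonical aeqb_equivRel := EquivRelPack aeqb_equiv.

Definition artin := {eq_quot aeqb_equivRel}%qT.
HB.instance Definition _ := Choice.on artin.

Definition cls (w : word V) : artin := (\pi_({eq_quot aeqb_equivRel}) w)%qT.

Lemma clsP w1 w2 : reflect (aeq G w1 w2) (cls w1 == cls w2).
Proof. by rewrite /cls eqquotE; apply: asboolP. Qed.

Lemma cls_eq w1 w2 : aeq G w1 w2 -> cls w1 = cls w2.
Proof. by move/clsP/eqP. Qed.

Definition word_of (g : artin) : word V := repr g.

Lemma word_ofK : cancel word_of cls. Proof. exact: reprK. Qed.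

Lemma aeq_word_of w : aeq G (word_of (cls w)) w.
Proof. by apply/clsP; rewrite word_ofK. Qed.

Definition artin_mul (g h : artin) := cls (word_of g ++ word_of h).
Definition artin_inv (g : artin) := cls (winv (word_of g)).

Lemma cls_mul w1 w2 : artin_mul (cls w1) (cls w2) = cls (w1 ++ w2).
Proof. by apply: cls_eq; apply: aeq_cat; apply: aeq_word_of. Qed.

Lemma cls_inv w : artin_inv (cls w) = cls (winv w).
Proof. by apply: cls_eq; apply: aeq_winv; apply: aeq_word_of. Qed.

Lemma artin_mulA : associative artin_mul.
Proof.
by move=> g h k; rewrite -(word_ofK g) -(word_ofK h) -(word_ofK k) !cls_mul catA.
Qed.

Lemma artin_mul1 : left_id (cls [::]) artin_mul.
Proof. by move=> g; rewrite -(word_ofK g) cls_mul. Qed.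

Lemma artin_mulr1 : right_id (cls [::]) artin_mul.
Proof. by move=> g; rewrite -(word_ofK g) cls_mul cats0. Qed.

Lemma artin_mulV : left_inverse (cls [::]) artin_inv artin_mul.
Proof.
by move=> g; rewrite -(word_ofK g) cls_inv cls_mul; apply/cls_eq/aeq_winvl.
Qed.

Lemma artin_mulrV : right_inverse (cls [::]) artin_inv artin_mul.
Proof.
by move=> g; rewrite -(word_ofK g) cls_inv cls_mul; apply/cls_eq/aeq_winvr.
Qed.

HB.instance Definition _ := isGroup.Build artin
  artin_mulA artin_mul1 artin_mulr1 artin_mulV artin_mulrV.

Lemma clsM w1 w2 : cls (w1 ++ w2) = cls w1 * cls w2.
Proof. by rewrite -cls_mul. Qed.

Lemma clsV w : cls (winv w) = (cls w)^-1.
Proof. by rewrite -cls_inv. Qed.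

Definition letter (l : bool * V) : artin := cls [:: l].
Definition gen x := letter (true, x).

Lemma cls_cons l w : cls (l :: w) = letter l * cls w.
Proof. by rewrite -cat1s clsM. Qed.

Lemma letterE b x : letter (b, x) = if b then gen x else (gen x)^-1.
Proof. by case: b => //; rewrite -clsV. Qed.

Lemma artin_ind (P : artin -> Prop) :
  P 1 -> (forall l g, P g -> P (letter l * g)) -> forall g, P g.
Proof.
move=> P1 PM g; rewrite -(word_ofK g).
by elim: (word_of g) => // l w IH; rewrite cls_cons; apply: PM.
Qed.

Lemma cls_nseq k w : cls (flatten (nseq k w)) = cls w ^+ k.
Proof. by elim: k => //= k IH; rewrite clsM IH expgS. Qed.

Hypothesis evenG : forall u v, adj G u v -> ~~ odd (lab G u v).

Lemma prodw_even (u v : V) k :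
  prodw u v k.*2 = flatten (nseq k [:: (true, u); (true, v)]).
Proof.
rewrite /prodw; elim: k => // k IH; rewrite doubleS /mkseq.
rewrite -[k.*2.+2]/(2 + k.*2) iotaD map_cat /= -IH; congr [:: _, _ & _].
have -> : iota 2 k.*2 = [seq 2 + i | i <- iota 0 k.*2] by rewrite -iotaDl.
by rewrite /mkseq -map_comp; apply: eq_map => i /=; rewrite negbK.
Qed.

Lemma prodw_lab u v : adj G u v ->
  prodw u v (lab G u v) = flatten (nseq (lab G u v)./2 [:: (true, u); (true, v)]).
Proof. by move=> /evenG/even_halfK {1}<-; apply: prodw_even. Qed.

Lemma artin_rel u v : adj G u v ->
  (gen u * gen v) ^+ (lab G u v)./2 = (gen v * gen u) ^+ (lab G u v)./2.
Proof.
move=> uv; have vu : adj G v u by rewrite adj_sym.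
have := cls_eq (aeq_rel [::] [::] uv).
rewrite /= !cats0 (lab_sym uv) (prodw_lab vu) -(lab_sym uv) (prodw_lab uv).
by rewrite !cls_nseq !cls_cons /= !mulg1.
Qed.

(** * Actions of the Artin group from actions of its letters *)

Section Run.
Variables (X : Type) (inv : X -> Prop) (ev : bool * V -> X -> X).
Hypothesis ev_inv : forall l s, inv s -> inv (ev l s).
Hypothesis evK : forall b x s, inv s -> ev (b, x) (ev (~~ b, x) s) = s.
Hypothesis ev_rel : forall u v s, adj G u v -> inv s ->
  iter (lab G u v)./2 (fun s => ev (true, u) (ev (true, v) s)) s =
  iter (lab G u v)./2 (fun s => ev (true, v) (ev (true, u) s)) s.

Lemma foldr_ev_inv w s : inv s -> inv (foldr ev s w).
Proof. by move=> s0; elim: w => //= l w; apply: ev_inv. Qed.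

Lemma foldr_ev_nseq k u v s :
  foldr ev s (flatten (nseq k [:: u; v])) = iter k (fun s => ev u (ev v s)) s.
Proof. by elim: k => //= k ->. Qed.

Lemma foldr_ev_aeq w1 w2 s : aeq G w1 w2 -> inv s -> foldr ev s w1 = foldr ev s w2.
Proof.
move=> e12; elim: e12 s => [w|u1 u2 _ IH|u1 u2 u3 _ IH1 _ IH2|p q b x|p q u v uv] s s0.
- by [].
- by rewrite IH.
- by rewrite IH1 ?IH2.
- by rewrite !foldr_cat /= evK //; apply: foldr_ev_inv.
- have vu : adj G v u by rewrite adj_sym.
  rewrite !foldr_cat (lab_sym uv) (prodw_lab vu) -(lab_sym uv) (prodw_lab uv).
  by rewrite !foldr_ev_nseq ev_rel //; apply: foldr_ev_inv.
Qed.

(** The common source of the retractions, the degrees and both kinds of normal form. On states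
    satisfying [inv] the chosen word for [g] is immaterial, by [foldr_ev_aeq]. *)
Definition run (g : artin) s := foldr ev s (word_of g).

Lemma run_cls w s : inv s -> run (cls w) s = foldr ev s w.
Proof. by apply: foldr_ev_aeq; apply: aeq_word_of. Qed.

Lemma run_inv g s : inv s -> inv (run g s).
Proof. exact: foldr_ev_inv. Qed.

Lemma run1 s : inv s -> run 1 s = s.
Proof. exact: (@run_cls [::]). Qed.

Lemma runM g h s : inv s -> run (g * h) s = run g (run h s).
Proof.
by move=> s0; rewrite -{1}(word_ofK g) -{1}(word_ofK h) -clsM run_cls // foldr_cat.
Qed.

Lemma run_letter l s : inv s -> run (letter l) s = ev l s.
Proof. exact: run_cls. Qed.

End Run.

End ArtinGroup.

(** * Retractions onto standard parabolic subgroups, and degrees *)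

Section Retractions.
Variables (V : finType) (G : ATsystem V).
Hypothesis evenG : forall u v, adj G u v -> ~~ odd (lab G u v).
Local Notation artin := (artin G).
Local Notation letter := (letter G).
Local Notation gen := (gen G).

Lemma iter_eq (X : Type) (f g : X -> X) k x : f =1 g -> iter k f x = iter k g x.
Proof. by move=> fg; elim: k => //= k ->. Qed.

(* Killing the generators outside [S] respects the relations because all labels
   are even. *)
Definition ev_retr (S : {set V}) (l : bool * V) (g : artin) :=
  if l.2 \in S then letter l * g else g.

Definition retr S (g : artin) : artin := run (ev_retr S) g 1.

Lemma letterK b x (g : artin) : letter (b, x) * (letter (~~ b, x) * g) = g.
Proof. by rewrite !letterE; case: b; rewrite /= ?mulVKg ?mulKg. Qed.

Lemma ev_retrK S b x g : True -> ev_retr S (b, x) (ev_retr S (~~ b, x) g) = g.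
Proof. by rewrite /ev_retr /= => _; case: (x \in S); rewrite ?letterK. Qed.

Lemma ev_retr_rel S u v g : adj G u v -> True ->
  iter (lab G u v)./2 (fun g => ev_retr S (true, u) (ev_retr S (true, v) g)) g =
  iter (lab G u v)./2 (fun g => ev_retr S (true, v) (ev_retr S (true, u) g)) g.
Proof.
move=> uv _; rewrite /ev_retr /=; case: (u \in S); case: (v \in S) => //.
have E (x y : artin) k : iter k (fun g => x * (y * g)) g = (x * y) ^+ k * g.
  by rewrite -iter_mulg; apply: iter_eq => h; rewrite mulgA.
by rewrite !E (artin_rel evenG uv).
Qed.

Let rI (X : Type) (l : bool * V) (x : X) (_ : True) : True := I.

Lemma run_retr S g h : run (ev_retr S) g h = retr S g * h.
Proof.
have R := run1 evenG (@rI _) (@ev_retrK S) (@ev_retr_rel S).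
have RM := runM evenG (@rI _) (@ev_retrK S) (@ev_retr_rel S).
have RL := run_letter evenG (@rI _) (@ev_retrK S) (@ev_retr_rel S).
elim/artin_ind: g => [|l g IH]; first by rewrite /retr !R // mul1g.
rewrite /retr !RM // !RL // IH -/(retr S g) /ev_retr.
by case: ifP => //; rewrite mulgA.
Qed.

Lemma retr1 S : retr S 1 = 1.
Proof. exact: (run1 evenG (@rI _) (@ev_retrK S) (@ev_retr_rel S)). Qed.

Lemma retrM S : {morph retr S : g h / g * h}.
Proof.
move=> g h; rewrite {1}/retr.
by rewrite (runM evenG (@rI _) (@ev_retrK S) (@ev_retr_rel S)) // run_retr.
Qed.

Lemma retr_letter S l : retr S (letter l) = if l.2 \in S then letter l else 1.
Proof.
rewrite /retr (run_letter evenG (@rI _) (@ev_retrK S) (@ev_retr_rel S)) //.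
by rewrite /ev_retr mulg1.
Qed.

Lemma retrV S : {morph retr S : g / g^-1}.
Proof. by move=> g; apply/esym/mulg1_eq; rewrite -retrM mulgV retr1. Qed.

Lemma retrX S n : {morph retr S : g / g ^+ n}.
Proof.
by move=> g; elim: n => [|n IH]; rewrite ?retr1 // !expgS retrM IH.
Qed.

Lemma retr_comp S T g : retr S (retr T g) = retr (S :&: T) g.
Proof.
elim/artin_ind: g => [|l g IH]; first by rewrite !retr1.
rewrite !retrM IH !retr_letter inE; case: (l.2 \in T); rewrite ?andbF ?retr1 //.
by rewrite andbT retr_letter.
Qed.

(** The standard parabolic subgroup as the fixed points of its retraction; [par_wordP] compares this
    with words over [S]. *)
Definition par S : {pred artin} := [pred g | retr S g == g].

Lemma parP S g : reflect (retr S g = g) (g \in par S).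
Proof. exact: eqP. Qed.

Lemma par_closed S : group_closed (par S).
Proof.
split=> [|g h /parP gS /parP hS]; apply/parP; first exact: retr1.
by rewrite retrM retrV gS hS.
Qed.

Lemma retr_par S T g : g \in par T -> retr S g \in par (S :&: T).
Proof.
move/parP <-; apply/parP; rewrite !retr_comp; congr (retr _ g).
by apply/setP=> x; rewrite !inE; case: (x \in S); case: (x \in T).
Qed.

Lemma par_sub (S T : {set V}) : S \subset T -> {subset par S <= par T}.
Proof.
by move=> ST g /parP gS; apply/parP; rewrite -gS retr_comp (setIidPr ST).
Qed.

Lemma retr_in S g : retr S g \in par S.
Proof. by apply/parP; rewrite retr_comp setIid. Qed.

Lemma par_retr_sub (S T : {set V}) g : S \subset T -> retr S g \in par T.
Proof. by move=> ST; apply: (par_sub ST); apply: retr_in. Qed.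

Lemma letter_par (S : {set V}) l : l.2 \in S -> letter l \in par S.
Proof. by move=> lS; apply/parP; rewrite retr_letter lS. Qed.

Lemma par_ind (S : {set V}) (P : artin -> Prop) : P 1 ->
  (forall l g, l.2 \in S -> g \in par S -> P g -> P (letter l * g)) ->
  {in par S, forall g, P g}.
Proof.
move=> P1 PM g /parP <-; elim/artin_ind: g => [|l g IH]; first by rewrite retr1.
rewrite retrM retr_letter; case: ifP => [lS|]; last by rewrite mul1g.
by apply: PM => //; apply: retr_in.
Qed.

Lemma par_wordP (S : {set V}) g :
  g \in par S <-> exists2 w : word V, all (fun l => l.2 \in S) w & cls G w = g.
Proof.
split=> [|[w Sw <-]].
  move: g; apply: par_ind => [|l g lS _ [w Sw <-]]; first by exists [::].
  by exists (l :: w); rewrite /= ?lS // cls_cons.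
elim: w Sw => [_|l w IH /= /andP[lS /IH]]; first exact: closed1 (par_closed S).
by rewrite cls_cons; apply: (closedM (par_closed S)); apply: letter_par.
Qed.

(** Yields the exponent sum in [v]: with an even label both sides of a relation contain [v] equally
    often. *)
Definition ev_deg (v : V) (l : bool * V) (i : int) : int :=
  (if l.2 == v then (-1) ^+ (~~ l.1) + i else i)%R.

Definition deg v (g : artin) : int := run (ev_deg v) g 0%R.

Lemma ev_degK v b x i : True -> ev_deg v (b, x) (ev_deg v (~~ b, x) i) = i.
Proof.
by rewrite /ev_deg /= => _; case: (x == v) => //; case: b; rewrite /=; lia.
Qed.

Lemma ev_deg_rel v x y i : adj G x y -> True ->
  iter (lab G x y)./2 (fun i => ev_deg v (true, x) (ev_deg v (true, y) i)) i =
  iter (lab G x y)./2 (fun i => ev_deg v (true, y) (ev_deg v (true, x) i)) i.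
Proof.
by move=> _ _; apply: iter_eq => j; rewrite /ev_deg /=; case: (x == v); case: (y == v).
Qed.

Lemma run_deg v g i : run (ev_deg v) g i = (deg v g + i)%R.
Proof.
have R := run1 evenG (@rI _) (@ev_degK v) (@ev_deg_rel v).
have RM := runM evenG (@rI _) (@ev_degK v) (@ev_deg_rel v).
have RL := run_letter evenG (@rI _) (@ev_degK v) (@ev_deg_rel v).
elim/artin_ind: g => [|l g IH]; first by rewrite /deg !R // add0r.
rewrite /deg !RM // !RL // IH -/(deg v g) /ev_deg.
by case: ifP => //; rewrite addrA.
Qed.

Lemma deg1 v : deg v 1 = 0%R.
Proof. exact: (run1 evenG (@rI _) (@ev_degK v) (@ev_deg_rel v)). Qed.

Lemma degM v g h : deg v (g * h) = (deg v g + deg v h)%R.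
Proof.
rewrite {1}/deg.
by rewrite (runM evenG (@rI _) (@ev_degK v) (@ev_deg_rel v)) // run_deg.
Qed.

Lemma deg_gen v x : deg v (gen x) = (x == v)%:R%R.
Proof.
rewrite /deg (run_letter evenG (@rI _) (@ev_degK v) (@ev_deg_rel v)) //.
by rewrite /ev_deg /= addr0; case: eqP.
Qed.

Lemma degV v g : deg v g^-1 = (- deg v g)%R.
Proof. by apply/esym/addr0_eq; rewrite -degM mulgV deg1. Qed.

Lemma degX v g n : deg v (g ^+ n) = (deg v g *+ n)%R.
Proof. by elim: n => [|n IH]; rewrite ?deg1 // expgS degM IH mulrS. Qed.

Lemma degJ v g h : deg v (g * h * g^-1) = deg v h.
Proof. by rewrite !degM degV; lia. Qed.

Lemma deg_letter v l : l.2 != v -> deg v (letter l) = 0%R.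
Proof.
by case: l => -[] x /= /negPf xv; rewrite letterE ?degV deg_gen xv.
Qed.

Lemma deg_par v (S : {set V}) : v \notin S -> {in par S, forall g, deg v g = 0%R}.
Proof.
move=> vS; apply: par_ind => [|l g lS _ dg]; first exact: deg1.
by rewrite degM dg deg_letter // (memPn vS).
Qed.

Lemma degX_eq0 v g n : 0 < n -> deg v (g ^+ n) = 0%R -> deg v g = 0%R.
Proof.
rewrite degX -mulr_natr natz => n0 /eqP.
by rewrite mulf_eq0 => /orP[/eqP //|]; lia.
Qed.

End Retractions.

(** * Powers with integer exponents *)

Section IntegerPowers.
Variable G : groupType.
Implicit Types (g h : G) (i j : int).

Definition zpow g i := match i with Posz n => g ^+ n | Negz n => g ^- n.+1 end.

Lemma zpow0 g : zpow g 0%R = 1. Proof. by []. Qed.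

Lemma zpowS g i : zpow g (i + 1)%R = zpow g i * g.
Proof.
case: i => [n|[|n]].
- by rewrite -[(Posz n + 1)%R]/(Posz (n + 1)) addn1 /= expgSr.
- by rewrite /= mulVg.
- have -> : (Negz n.+1 + 1)%R = Negz n by lia.
  by rewrite /= [in RHS]expgS invgM mulgVK.
Qed.

Lemma zpowD g i j : zpow g (i + j)%R = zpow g i * zpow g j.
Proof.
elim/int_rec: j => [|n IH|n IH].
- by rewrite addr0 mulg1.
- by rewrite intS [(1 + _)%R]addrC addrA zpowS IH zpowS mulgA.
- apply: (mulIg g); rewrite -mulgA -!zpowS.
  have -> : (- n.+1%:Z + 1 = - n%:Z)%R by lia.
  have -> : (i - n.+1%:Z + 1 = i - n%:Z)%R by lia.
  by rewrite IH.
Qed.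

Lemma zpowN g i : zpow g (- i)%R = (zpow g i)^-1.
Proof. by apply/esym/mulg1_eq; rewrite -zpowD subrr. Qed.

Lemma zpow_mulrn g i n : zpow g (i *+ n)%R = zpow g i ^+ n.
Proof. by elim: n => //= n IH; rewrite mulrS zpowD IH expgS. Qed.

Lemma zpowX g n i : zpow (g ^+ n) i = zpow g (i *+ n)%R.
Proof.
by case: i => k; rewrite zpow_mulrn /= ?expVgn expgnAC.
Qed.

Lemma commute_zpow g h i : commute g h -> commute g (zpow h i).
Proof. by case: i => n gh /=; [|apply: commuteV]; apply: commuteX. Qed.

Lemma zpow_closed (S : {pred G}) g i : group_closed S -> g \in S -> zpow g i \in S.
Proof.
by move=> gS Sg; case: i => n /=; rewrite ?(closedV gS) ?(closedX gS).
Qed.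

End IntegerPowers.

(** * Splitting over the link of a vertex *)

Section StarAmalgam.
Variables (V : finType) (G : ATsystem V).
Hypothesis evenG : forall u v, adj G u v -> ~~ odd (lab G u v).
Local Notation letter := (letter G).
Local Notation gen := (gen G).
Local Notation par := (@par V G).
Local Notation run := (@run V G _).
Variables (W : {set V}) (u : V).
Hypothesis uW : u \in W.

Definition link : {set V} := [set x in W | adj G x u].

Lemma link_sub : link \subset W.
Proof. by apply/subsetP=> x; rewrite inE => /andP[]. Qed.

Lemma linkN : u \notin link.
Proof. by rewrite inE (negPf (adj_irr G u)) andbF. Qed.

(** [true] is the side without [u], [false] the star of [u]; they meet in the link. *)
Definition star_set (t : bool) := if t then W :\ u else u |: link.

Definition star_factor (t : bool) := par (star_set t).

(** The only element of the coset of [a] with trivial retraction to the link. Kernels are normal, so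
    conjugation by the link preserves these representatives. *)
Definition star_rep (t : bool) (a : artin G) := a * (retr link a)^-1.

Lemma star_factor_closed t : group_closed (star_factor t).
Proof. exact: par_closed. Qed.

Lemma star_sub_edge t : {subset par link <= star_factor t}.
Proof.
apply: par_sub => //; case: t => /=; last exact: subsetUr.
by rewrite subsetD1 link_sub linkN.
Qed.

Lemma star_rep_coset t : {in star_factor t, forall a, (star_rep t a)^-1 * a \in par link}.
Proof. by move=> a _; rewrite /star_rep ?gnorm retr_in. Qed.

Lemma star_repMr t : {in star_factor t & par link, forall a e,
  star_rep t (a * e) = star_rep t a}.
Proof. by move=> a e _ /parP eL; rewrite /star_rep retrM // eL ?gnorm. Qed.

Lemma star_repMl t : {in star_factor t & par link, forall a e,
  star_rep t (e * a) = e * star_rep t a * e^-1}.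
Proof. by move=> a e _ /parP eL; rewrite /star_rep retrM // eL ?gnorm. Qed.

Lemma star_rep1 t : star_rep t 1 = 1.
Proof. by rewrite /star_rep retr1 // mulgV. Qed.

Definition star_amalgam := Amalgam star_factor_closed (par_closed evenG link)
  star_sub_edge star_rep_coset star_repMr star_repMl star_rep1.
Local Notation D := star_amalgam.

Definition ev_star (l : bool * V) (s : seq (bool * artin G)) :=
  if l.2 \in W then act D (l.2 != u) (letter l) s else s.

Definition star_nf (g : artin G) := run ev_star g [::].

Lemma star_set_letter (l : bool * V) : l.2 \in W -> l.2 \in star_set (l.2 != u).
Proof. by rewrite /star_set; case: eqP => [->|/eqP lu] lW; rewrite !inE ?eqxx ?lu. Qed.

Lemma ev_star_normal l s : normal D s -> normal D (ev_star l s).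
Proof.
move=> ns; rewrite /ev_star; case: ifP => // lW.
by apply: normal_act => //; apply/letter_par/star_set_letter.
Qed.

Lemma ev_starK b x s : normal D s -> ev_star (b, x) (ev_star (~~ b, x) s) = s.
Proof.
move=> ns; rewrite /ev_star /=; case xW: (x \in W) => //.
have Hx b' : letter (b', x) \in factor D (x != u).
  exact/letter_par/(@star_set_letter (b', x)).
apply: actK => //.
by rewrite -[letter (~~ b, x)]mulg1 letterK.
Qed.

(** A vertex of the link belongs to both sides, but its letter is then an edge element, on which
    both actions agree. *)
Lemma ev_star_act t l s : l.2 \in W -> l.2 \in star_set t -> normal D s ->
  ev_star l s = act D t (letter l) s.
Proof.
move=> lW lt ns; rewrite /ev_star lW; have [<-//|lut] := eqVneq (l.2 != u) t.
have lE : letter l \in edge D.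
  apply: letter_par => //; move: lt lut; rewrite /star_set; case: t.
    by rewrite !inE => /andP[->].
  by rewrite in_setU1; case: (l.2 == u).
by rewrite !actE.
Qed.

(** Two adjacent vertices of [W] lie in a common side: if one is [u], the other is in the link. The
    relation then holds in that factor, hence for its action. A letter outside [W] acts trivially,
    and the two iterates coincide. *)
Lemma ev_star_rel x y s : adj G x y -> normal D s ->
  iter (lab G x y)./2 (fun s => ev_star (true, x) (ev_star (true, y) s)) s =
  iter (lab G x y)./2 (fun s => ev_star (true, y) (ev_star (true, x) s)) s.
Proof.
move=> xy ns; have [xW|xW] := boolP (x \in W); last first.
  by apply: iter_eq => s'; rewrite /ev_star /= (negPf xW).
have [yW|yW] := boolP (y \in W); last first.
  by apply: iter_eq => s'; rewrite /ev_star /= (negPf yW).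
have [t xt yt] : exists2 t, x \in star_set t & y \in star_set t.
  have [xu|xu] := eqVneq x u.
    by exists false; rewrite /star_set !inE ?xu ?eqxx // yW adj_sym -xu xy orbT.
  have [yu|yu] := eqVneq y u.
    by exists false; rewrite /star_set !inE ?yu ?eqxx // xW -yu xy orbT.
  by exists true; rewrite /star_set !inE ?xu ?yu.
have Hx : gen x \in factor D t by apply: letter_par.
have Hy : gen y \in factor D t by apply: letter_par.
have E k a b : a \in W -> b \in W -> a \in star_set t -> b \in star_set t ->
    iter k (fun s => ev_star (true, a) (ev_star (true, b) s)) s =
    act D t ((gen a * gen b) ^+ k) s.
  move=> aW bW at_ bt.
  have Ha : gen a \in factor D t by apply: letter_par.
  have Hb : gen b \in factor D t by apply: letter_par.
  rewrite -(iter_act2 _ Ha Hb ns).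
  elim: k => //= k IH; rewrite IH.
  set s' := iter _ _ _; have ns' : normal D s'.
    rewrite {}/s'; elim: (k) => //= j IHj.
    by do 2 apply: normal_act => //.
  by rewrite !(@ev_star_act t) ?normal_act.
by rewrite !E // (artin_rel evenG xy).
Qed.

Lemma star_run1 s : normal D s -> run ev_star 1 s = s.
Proof. exact: (run1 evenG ev_star_normal ev_starK ev_star_rel). Qed.

Lemma star_runM g h s : normal D s ->
  run ev_star (g * h) s = run ev_star g (run ev_star h s).
Proof. exact: (runM evenG ev_star_normal ev_starK ev_star_rel). Qed.

Lemma star_run_letter l s : normal D s -> run ev_star (letter l) s = ev_star l s.
Proof. exact: (run_letter evenG ev_star_normal ev_starK ev_star_rel). Qed.

Lemma star_run_normal g s : normal D s -> normal D (run ev_star g s).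
Proof. exact: (run_inv ev_star_normal). Qed.

Lemma star_set_sub t : star_set t \subset W.
Proof.
by case: t; rewrite /star_set ?subsetDl // subUset sub1set uW link_sub.
Qed.

Lemma star_run_act t : {in star_factor t, forall a s, normal D s ->
  run ev_star a s = act D t a s}.
Proof.
apply: (par_ind evenG) => [|l g lt gt IH] s ns; first by rewrite star_run1 ?act1.
have lW := subsetP (star_set_sub t) _ lt.
have Hl : letter l \in factor D t by apply: letter_par.
rewrite star_runM // star_run_letter ?star_run_normal // IH //.
by rewrite (@ev_star_act t) ?normal_act // -actM.
Qed.

Lemma star_normal_form : normal_form D (par W) star_nf.
Proof.
have n0 : normal D [::] by [].
split=> [|t a Ha g|g|].
- exact: star_run1.
- by rewrite /star_nf star_runM // (star_run_act Ha) // star_run_normal.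
- exact: star_run_normal.
apply: (par_ind evenG) => [|l g lW gW IH].
  by rewrite /star_nf star_run1 //= invg1 mulg1 (closed1 (par_closed evenG _)).
have Hl : letter l \in factor D (l.2 != u) by apply/letter_par/star_set_letter.
have ng : normal D (star_nf g) by apply: star_run_normal.
rewrite /star_nf star_runM // (star_run_act Hl) -/(star_nf g) //.
have := closedM (par_closed evenG _) (sprod_act Hl ng) IH.
by rewrite ?gnorm.
Qed.

(** Retracting an element of [par T] to the link stays in [par T], hence so do the coset
    representatives. *)
Lemma star_nf_par (T : {set V}) g : T \subset W -> g \in par T ->
  all [pred x | x.2 \in par T] (star_nf g).
Proof.
move=> TW; move: g; apply: (par_ind evenG) => [|l g lT gT IH].
  by rewrite /star_nf star_run1.
have lW := subsetP TW _ lT.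
have Hl : letter l \in factor D (l.2 != u) by apply/letter_par/star_set_letter.
rewrite /star_nf star_runM // (star_run_act Hl) ?star_run_normal // -/(star_nf g).
apply: all_act IH; [exact: par_closed | | exact: letter_par].
move=> t b bT /=; rewrite /star_rep (closedM (par_closed evenG T)) //.
rewrite (closedV (par_closed evenG T)) //.
by apply: par_sub (retr_par evenG link bT) => //; apply: subsetIr.
Qed.

End StarAmalgam.

(** * Dihedral Artin groups *)

Section Dihedral.
Variables (V : finType) (G : ATsystem V).
Hypothesis evenG : forall u v, adj G u v -> ~~ odd (lab G u v).
Local Notation letter := (letter G).
Local Notation gen := (gen G).
Local Notation par := (@par V G).
Local Notation run := (@run V G _).
Variables (u v : V).
Hypothesis uv : adj G u v.
Let k := (lab G u v)./2.
Let x := gen u * gen v.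
Let z := x ^+ k.

Lemma deg_zpow (w : V) (g : artin G) i : deg w (zpow g i) = (deg w g * i)%R.
Proof.
case: i => n /=; first by rewrite degX // -mulr_natr natz.
by rewrite degV // degX // -mulr_natr natz; lia.
Qed.

Lemma adj_neq : u != v.
Proof. by apply: contraTneq uv => ->; apply: adj_irr. Qed.

Lemma half_lab_gt0 : 0 < k.
Proof. by rewrite half_gt0; apply: lab_ge2. Qed.

Let degE0 := (degM evenG, deg_zpow, deg_gen evenG, degX evenG, degV evenG,
  eqxx, negPf adj_neq, eq_sym v u, mulr0n, mulr1n).

Lemma deg_v_x : deg v x = 1%R.
Proof. by rewrite /x !degE0. Qed.

Lemma deg_u_x : deg u x = 1%R.
Proof. by rewrite /x !degE0. Qed.

Lemma deg_v_z : deg v z = k.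
Proof. by rewrite /z degX // deg_v_x natz. Qed.

Lemma deg_u_z : deg u z = k.
Proof. by rewrite /z degX // deg_u_x natz. Qed.

Let degE := (deg_v_z, deg_u_z, deg_v_x, deg_u_x, degE0).

Lemma commute_z_u : commute z (gen u).
Proof.
have E j : gen u * (gen v * gen u) ^+ j = (gen u * gen v) ^+ j * gen u.
  elim: j => [|j IH]; first by rewrite !expg0 mulg1 mul1g.
  by rewrite expgSr mulgA IH expgSr !mulgA.
by rewrite /commute /z -E -(artin_rel evenG uv).
Qed.

Lemma commute_z_x : commute z x.
Proof. by apply/commute_sym/commuteX. Qed.

(* With [x = uv] and [z = x ^+ k], the defining relation says that [z] commutes
   with [u]: the group is the amalgam of [<z> x <u>] and [<x>] over [<z>]. The
   exponents in the normal forms below are recovered from the degrees in [u]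
   and [v]. *)
Definition dihedral_edge : {pred artin G} :=
  [pred g | g == zpow z (deg v g %/ k)%Z].

Definition dihedral_factor (t : bool) : {pred artin G} :=
  if t then [pred g | g == zpow z (deg v g %/ k)%Z * zpow (gen u) (deg u g - deg v g)%R]
  else [pred g | g == zpow x (deg v g)].

(** As [z] has degree [k] in both [u] and [v], the difference of the degrees and the remainder
    modulo [k] both forget it. *)
Definition dihedral_rep (t : bool) (a : artin G) :=
  if t then zpow (gen u) (deg u a - deg v a)%R else zpow x (deg v a %% k)%Z.

Lemma dihedral_edgeP g : reflect (exists i, g = zpow z i) (g \in dihedral_edge).
Proof.
have k0 := half_lab_gt0.
apply: (iffP eqP) => [->|[i ->]]; first by eexists.
by rewrite deg_zpow deg_v_z mulrC mulzK //; lia.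
Qed.

Lemma dihedral_trueP g :
  reflect (exists i j, g = zpow z i * zpow (gen u) j) (g \in dihedral_factor true).
Proof.
have k0 := half_lab_gt0.
apply: (iffP eqP) => [->|[i [j ->]]]; first by do 2 eexists.
rewrite !degE mul0r addr0 mul1r mulrC mulzK; last by lia.
by congr (_ * zpow _ _); lia.
Qed.

Lemma dihedral_falseP g :
  reflect (exists i, g = zpow x i) (g \in dihedral_factor false).
Proof.
apply: (iffP eqP) => [->|[i ->]]; first by eexists.
by rewrite deg_zpow deg_v_x mul1r.
Qed.

Lemma dihedral_edge_closed : group_closed dihedral_edge.
Proof.
split=> [|g h /dihedral_edgeP[i ->] /dihedral_edgeP[j ->]]; apply/dihedral_edgeP.
  by exists 0%R.
by exists (i - j)%R; rewrite zpowD zpowN.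
Qed.

Lemma commute_zpow2 i j : commute (zpow z i) (zpow (gen u) j).
Proof. by apply/commute_zpow/commute_sym/commute_zpow/commute_sym/commute_z_u. Qed.

Lemma dihedral_factor_closed t : group_closed (dihedral_factor t).
Proof.
case: t; last first.
  split=> [|g h /dihedral_falseP[i ->] /dihedral_falseP[j ->]];
    apply/dihedral_falseP.
    by exists 0%R.
  by exists (i - j)%R; rewrite zpowD zpowN.
split=> [|g h /dihedral_trueP[i [j ->]] /dihedral_trueP[i' [j' ->]]];
  apply/dihedral_trueP.
  by exists 0%R, 0%R; rewrite /= mulg1.
exists (i - i')%R, (j - j')%R; rewrite !zpowD invgM -!zpowN.
rewrite -!mulgA; congr (_ * _).
by rewrite mulgA -!zpowD commute_zpow2.
Qed.

Lemma dihedral_sub_edge t : {subset dihedral_edge <= dihedral_factor t}.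
Proof.
move=> e /dihedral_edgeP[i ->]; case: t.
  by apply/dihedral_trueP; exists i, 0%R; rewrite mulg1.
by apply/dihedral_falseP; exists (i *+ k)%R; rewrite zpowX.
Qed.

Lemma dihedral_rep_coset t :
  {in dihedral_factor t, forall a, (dihedral_rep t a)^-1 * a \in dihedral_edge}.
Proof.
case: t => a.
  move=> /eqP ea; apply/dihedral_edgeP; exists (deg v a %/ k)%Z.
  by rewrite {2}ea commute_zpow2 mulKg.
move=> /eqP ea; apply/dihedral_edgeP; exists (deg v a %/ k)%Z.
rewrite zpowX /dihedral_rep; apply: (mulgI (zpow x (deg v a %% k)%Z)).
rewrite mulVKg -zpowD {1}ea; congr zpow.
by rewrite {1}(divz_eq (deg v a) k) addrC -mulr_natr natz.
Qed.

Lemma dihedral_edge_rep t : {in dihedral_factor t & dihedral_edge, forall a e,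
  dihedral_rep t (e * a) = dihedral_rep t a /\ commute e (dihedral_rep t a)}.
Proof.
move=> a e _ /dihedral_edgeP[i ->]; case: t; rewrite /dihedral_rep; split.
- by rewrite !degE; congr zpow; lia.
- exact: commute_zpow2.
- by rewrite !degE mulrC modzMDl.
- by apply/commute_zpow/commute_sym/commute_zpow/commute_sym/commute_z_x.
Qed.

Lemma dihedral_repMr t : {in dihedral_factor t & dihedral_edge, forall a e,
  dihedral_rep t (a * e) = dihedral_rep t a}.
Proof.
move=> a e Ha Ee; have [<- _] := dihedral_edge_rep Ha Ee.
rewrite /dihedral_rep !(degM evenG).
by rewrite [(deg u a + _)%R]addrC [(deg v a + _)%R]addrC.
Qed.

Lemma dihedral_repMl t : {in dihedral_factor t & dihedral_edge, forall a e,
  dihedral_rep t (e * a) = e * dihedral_rep t a * e^-1}.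
Proof.
by move=> a e Ha Ee; have [-> ->] := dihedral_edge_rep Ha Ee; rewrite mulgK.
Qed.

Lemma dihedral_rep1 t : dihedral_rep t 1 = 1.
Proof. by case: t; rewrite /dihedral_rep !deg1 ?mod0z. Qed.

Definition dihedral_amalgam := Amalgam dihedral_factor_closed
  dihedral_edge_closed dihedral_sub_edge dihedral_rep_coset dihedral_repMr
  dihedral_repMl dihedral_rep1.
Local Notation D := dihedral_amalgam.

(** The letter [v] is spelled through the factors as [(gen u)^-1 * x], its inverse as
    [x^-1 * gen u]. *)
Definition ev_dihedral (l : bool * V) (s : seq (bool * artin G)) :=
  if l.2 == u then act D true (letter l) s else
  if l.2 == v then
    if l.1 then act D true (gen u)^-1 (act D false x s)
    else act D false x^-1 (act D true (gen u) s)
  else s.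

Let Hu : gen u \in factor D true.
Proof. by apply/dihedral_trueP; exists 0%R, 1%R; rewrite mul1g. Qed.

Let HuV : (gen u)^-1 \in factor D true.
Proof. exact: closedV (dihedral_factor_closed true) _ Hu. Qed.

Let Hx : x \in factor D false.
Proof. by apply/dihedral_falseP; exists 1%R. Qed.

Let HxV : x^-1 \in factor D false.
Proof. exact: closedV (dihedral_factor_closed false) _ Hx. Qed.

Lemma letter_u b : letter (b, u) \in factor D true.
Proof. by rewrite letterE; case: b. Qed.

Lemma ev_dihedral_normal l s : normal D s -> normal D (ev_dihedral l s).
Proof.
move=> ns; rewrite /ev_dihedral; case: ifP => [/eqP lu|_].
  by apply: normal_act => //; case: l lu => b w /= ->; apply: letter_u.
by case: ifP => // _; case: ifP => _; do 2 apply: normal_act => //.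
Qed.

Lemma ev_dihedralK b w s : normal D s ->
  ev_dihedral (b, w) (ev_dihedral (~~ b, w) s) = s.
Proof.
move=> ns; rewrite /ev_dihedral /=; case: eqP => [->|_].
  apply: actK; rewrite ?letter_u //.
  by rewrite -[letter (~~ b, u)]mulg1 letterK.
case: eqP => // _; case: b => /=.
- by rewrite (actK Hx HxV) ?normal_act ?mulgV // (actK HuV Hu) ?mulVg.
- by rewrite (actK Hu HuV) ?normal_act ?mulgV // (actK HxV Hx) ?mulVg.
Qed.

Let Ez : z \in edge D.
Proof. by apply/dihedral_edgeP; exists 1%R. Qed.

Lemma ev_dihedral_uv s : normal D s ->
  ev_dihedral (true, u) (ev_dihedral (true, v) s) = act D false x s.
Proof.
move=> ns; rewrite /ev_dihedral /= !eqxx eq_sym (negPf adj_neq).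
by rewrite (actK Hu HuV) ?normal_act // mulgV.
Qed.

Lemma iter_ev_dihedral_uv s : normal D s ->
  iter k (fun s => ev_dihedral (true, u) (ev_dihedral (true, v) s)) s =
  conjs z s.
Proof.
move=> ns; rewrite -(@actE _ D false) //.
rewrite /z; elim: k => [|j IH]; first by rewrite act1.
have Hj : x ^+ j \in factor D false by rewrite (closedX (dihedral_factor_closed false)).
by rewrite iterS IH ev_dihedral_uv ?normal_act // -actM // expgS.
Qed.

(** The word [vu] is the conjugate of [uv] by the inverse of [u], so the iterate is that of the
    other order, conjugated; since [z] commutes with [gen u], the conjugation cancels. *)
Lemma iter_ev_dihedral_vu s : normal D s ->
  iter k (fun s => ev_dihedral (true, v) (ev_dihedral (true, u) s)) s =
  conjs z s.
Proof.
move=> ns; pose s' := act D true (gen u) s.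
have ns' : normal D s' by apply: normal_act.
have E j : iter j (fun s => ev_dihedral (true, v) (ev_dihedral (true, u) s)) s =
    act D true (gen u)^-1
      (iter j (fun s => ev_dihedral (true, u) (ev_dihedral (true, v) s)) s').
  elim: j => [|j IH]; first by rewrite (actK HuV Hu) ?mulVg.
  set t := iter j _ s' in IH.
  have nt : normal D t.
    by rewrite /t; elim: (j) => //= i ni; do 2 apply: ev_dihedral_normal.
  rewrite !iterS IH -/t ev_dihedral_uv // {1 2}/ev_dihedral /= !eqxx.
  rewrite eq_sym (negPf adj_neq).
  by rewrite (actK Hu HuV) ?mulgV.
rewrite E iter_ev_dihedral_uv // -(@actE _ D true) // -(@actE _ D true) //.
have Hz : z \in factor D true by apply: dihedral_sub_edge.
rewrite -actM // /s' -actM ?(closedM (dihedral_factor_closed true)) //.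
by rewrite -mulgA commute_z_u mulKg.
Qed.

Lemma ev_dihedral_id b w s : w != u -> w != v -> ev_dihedral (b, w) s = s.
Proof. by rewrite /ev_dihedral /= => /negPf-> /negPf->. Qed.

Lemma ev_dihedral_rel y w s : adj G y w -> normal D s ->
  iter (lab G y w)./2 (fun s => ev_dihedral (true, y) (ev_dihedral (true, w) s)) s =
  iter (lab G y w)./2 (fun s => ev_dihedral (true, w) (ev_dihedral (true, y) s)) s.
Proof.
move=> yw ns.
have [/andP[yu yv]|yuv] := boolP ((y != u) && (y != v)).
  by apply: iter_eq => s'; rewrite !(@ev_dihedral_id _ y).
have [/andP[wu wv]|wuv] := boolP ((w != u) && (w != v)).
  by apply: iter_eq => s'; rewrite !(@ev_dihedral_id _ w).
have nyw : y != w by apply: contraTneq yw => ->; apply: adj_irr.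
move: yuv wuv; rewrite !negb_and !negbK.
move=> /orP[/eqP yE|/eqP yE] /orP[/eqP wE|/eqP wE]; subst y w; rewrite ?eqxx // in nyw *.
  by rewrite iter_ev_dihedral_uv // iter_ev_dihedral_vu.
by rewrite (lab_sym yw) iter_ev_dihedral_uv // iter_ev_dihedral_vu.
Qed.

Lemma dihedral_run1 s : normal D s -> run ev_dihedral 1 s = s.
Proof. exact: (run1 evenG ev_dihedral_normal ev_dihedralK ev_dihedral_rel). Qed.

Lemma dihedral_runM g h s : normal D s ->
  run ev_dihedral (g * h) s = run ev_dihedral g (run ev_dihedral h s).
Proof. exact: (runM evenG ev_dihedral_normal ev_dihedralK ev_dihedral_rel). Qed.

Lemma dihedral_run_letter l s : normal D s ->
  run ev_dihedral (letter l) s = ev_dihedral l s.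
Proof. exact: (run_letter evenG ev_dihedral_normal ev_dihedralK ev_dihedral_rel). Qed.

Lemma dihedral_run_normal g s : normal D s -> normal D (run ev_dihedral g s).
Proof. exact: (run_inv ev_dihedral_normal). Qed.

Definition acts_as t (a : artin G) := a \in factor D t /\
  (forall s, normal D s -> run ev_dihedral a s = act D t a s).

Lemma acts_asM t a b : acts_as t a -> acts_as t b -> acts_as t (a * b).
Proof.
move=> [Ha Ra] [Hb Rb]; split; first exact: closedM (dihedral_factor_closed t) _ _ Ha Hb.
by move=> s ns; rewrite dihedral_runM // Rb // Ra ?normal_act // actM.
Qed.

Lemma acts_asV t a : acts_as t a -> acts_as t a^-1.
Proof.
move=> [Ha Ra]; have HaV : a^-1 \in factor D t.
  exact: closedV (dihedral_factor_closed t) _ Ha.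
split=> // s ns; rewrite -{1}(actK Ha HaV (mulgV a) ns) -Ra ?normal_act //.
by rewrite -dihedral_runM ?normal_act // mulVg dihedral_run1 ?normal_act.
Qed.

Lemma acts_as1 t : acts_as t 1.
Proof.
split=> [|s ns]; first exact: closed1 (dihedral_factor_closed t).
by rewrite dihedral_run1 ?act1.
Qed.

Lemma acts_asX t a n : acts_as t a -> acts_as t (a ^+ n).
Proof.
move=> Ha; elim: n => [|n IH]; first exact: acts_as1.
by rewrite expgS; apply: acts_asM.
Qed.

Lemma acts_as_zpow t a i : acts_as t a -> acts_as t (zpow a i).
Proof. by case: i => n Ha /=; [|apply: acts_asV]; apply: acts_asX. Qed.

(** It suffices to treat [x], [gen u] and [z]. The last acts as a power of [x] in the factor
    [false], and [actE] carries this over to the factor [true]. *)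
Lemma factor_acts_as t a : a \in factor D t -> acts_as t a.
Proof.
have Ax : acts_as false x.
  split=> // s ns; rewrite dihedral_runM // !dihedral_run_letter //.
    by rewrite ev_dihedral_uv.
  exact: ev_dihedral_normal.
case: t; last by move=> /dihedral_falseP[i ->]; apply: acts_as_zpow.
move=> /dihedral_trueP[i [j ->]]; apply: acts_asM; apply: acts_as_zpow.
  split=> [|s ns]; first exact: dihedral_sub_edge.
  by have [_ ->] := acts_asX k Ax; rewrite // !actE.
by split=> // s ns; rewrite dihedral_run_letter // /ev_dihedral /= eqxx.
Qed.

Definition dihedral_nf (g : artin G) := run ev_dihedral g [::].

Lemma dihedral_normal_form : normal_form D (par [set u; v]) dihedral_nf.
Proof.
have n0 : normal D [::] by [].
split=> [|t a Ha g|g|].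
- exact: dihedral_run1.
- have [_ Ra] := factor_acts_as Ha.
  by rewrite /dihedral_nf dihedral_runM // Ra ?dihedral_run_normal.
- exact: dihedral_run_normal.
apply: (par_ind evenG) => [|l g lW gW IH].
  by rewrite /dihedral_nf dihedral_run1 //= invg1 mulg1 (closed1 dihedral_edge_closed).
have ng : normal D (dihedral_nf g) by apply: dihedral_run_normal.
have step t a h : a \in factor D t -> normal D (dihedral_nf h) ->
    (sprod (dihedral_nf h))^-1 * h \in edge D ->
    (sprod (dihedral_nf (a * h)))^-1 * (a * h) \in edge D.
  move=> Ha nh Eh; have [_ Ra] := factor_acts_as Ha.
  rewrite /dihedral_nf dihedral_runM // Ra // -/(dihedral_nf h).
  by have := closedM dihedral_edge_closed (sprod_act Ha nh) Eh; rewrite ?gnorm.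
have nn h : normal D (dihedral_nf h) by apply: dihedral_run_normal.
case: l lW => b w; rewrite !inE /= => /orP[/eqP->|/eqP->].
  by apply: step (letter_u b) _ _.
have -> : letter (b, v) = if b then (gen u)^-1 * x else x^-1 * gen u.
  by rewrite letterE /x; case: b; rewrite ?gnorm.
case: (b); rewrite -mulgA.
- by apply: (step true) => //; apply: (step false).
- by apply: (step false) => //; apply: (step true).
Qed.

(** Degree 0 in [v] passes from the power to [g], so [factor_root_closed] applies to the splitting
    over the powers of [z]. It puts [g] in the factor generated by [z] and [gen u], and degree 0 in
    [v] leaves no [z]. *)
Lemma dihedral_root_closed g n : g \in par [set u; v] -> 0 < n ->
  g ^+ n \in par [set u] -> g \in par [set u].
Proof.
move=> gK n0 gn.
have Pu : {in par [set u], forall h, exists j, h = zpow (gen u) j}.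
  apply: (par_ind evenG) => [|[b w] h /set1P /= wE _ [j ->]]; first by exists 0%R.
  by exists ((if b then 1 else -1) + j)%R; rewrite zpowD letterE [w]wE; case: b.
have uP : gen u \in par [set u] by apply: letter_par => //; apply: set11.
have dg : deg v g = 0%R.
  apply: (degX_eq0 evenG n0); apply: (deg_par evenG) gn.
  by rewrite inE eq_sym adj_neq.
have k0 := half_lab_gt0.
pose P := [pred h : artin G | deg v h == 0%R].
have Hg : g \in factor D true.
  apply: (factor_root_closed dihedral_normal_form (P := P) _ _ gK _ n0).
  - by move=> a b /=; rewrite degJ.
  (* In degree 0 in [v] the factor [true] reduces to the powers of [gen u], which meet the edge
     group only in 1, and the factor [false] reduces to 1. *)
  - move=> [] m s.
      move=> /dihedral_trueP[i [j ->]] /=; rewrite !degE mul0r addr0.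
      rewrite mulf_eq0 => /orP[|/eqP->]; first by lia.
      rewrite mul1g => nE m0; apply: contra nE => /dihedral_edgeP[i'].
      rewrite -zpow_mulrn => Eji.
      have di : i' = 0%R.
        have := congr1 (deg v) Eji; rewrite !degE mul0r => /esym/eqP.
        by rewrite mulf_eq0 => /orP[|/eqP//]; lia.
      have := congr1 (deg u) Eji; rewrite di !degE mulr0 mul1r -mulr_natr natz => /eqP.
      rewrite mulf_eq0 => /orP[/eqP->|]; last by lia.
      by rewrite zpow0 (closed1 dihedral_edge_closed).
    move=> /dihedral_falseP[i ->] /=; rewrite !degE mul1r => /eqP->.
    by rewrite (closed1 dihedral_edge_closed).
  - by rewrite /= dg.
  - have [j ->] := Pu _ gn; apply/dihedral_trueP.
    by exists 0%R, j; rewrite mul1g.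
have [i [j gE]] := dihedral_trueP _ Hg.
have i0 : i = 0%R.
  move: dg; rewrite gE !degE mul0r addr0 => /eqP.
  by rewrite mulf_eq0 => /orP[|/eqP//]; lia.
by rewrite gE i0 mul1g; apply: zpow_closed uP; apply: par_closed.
Qed.

End Dihedral.

(** * Parabolic subgroups are closed under roots *)

Section RootClosed.
Variables (V : finType) (G : ATsystem V).
Hypothesis FC : EAFC G.
Let evenG : forall u v, adj G u v -> ~~ odd (lab G u v).
Proof. by case: FC. Qed.
Local Notation letter := (letter G).
Local Notation gen := (gen G).
Local Notation par := (@par V G).
Let parC S : group_closed (par S) := par_closed evenG S.

Lemma gen_commute x y : adj G x y -> lab G x y = 2 -> commute (gen x) (gen y).
Proof. by move=> xy l2; have := artin_rel evenG xy; rewrite l2. Qed.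

Lemma par_setI (S T : {set V}) g : g \in par S -> g \in par T -> g \in par (S :&: T).
Proof. by move=> /parP {2}<- /(retr_par evenG S). Qed.

Section CommutingParabolics.
Variables S T : {set V}.
Hypothesis cST : {in S & T, forall x y, commute (gen x) (gen y)}.

Lemma par_commute : {in par S & par T, forall g h, commute g h}.
Proof.
have L b x h : commute h (gen x) -> commute h (letter (b, x)).
  by move=> c; rewrite letterE; case: b => //; apply: commuteV.
move=> g h gS; move: h; apply: (par_ind evenG) => [|[c y] h yT _ IH].
  exact: commute1.
apply: commuteM IH; apply: (L); apply: commute_sym; move: g gS.
apply: (par_ind evenG) => [|[b x] g xS _ IH]; first exact: commute1.
by apply: commuteM IH; apply: (L); apply: commute_sym; apply: cST.
Qed.

Hypothesis dST : [disjoint S & T].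

Lemma par_setU : {in par (S :|: T), forall g, g = retr S g * retr T g}.
Proof.
apply: (par_ind evenG) => [|l g lST _ IH]; first by rewrite !retr1 // mulg1.
rewrite !retrM // !retr_letter //; case lS : (l.2 \in S).
  by rewrite (disjointFr dST lS) mul1g -mulgA -IH.
move: lST; rewrite inE lS /= => lT; rewrite lT mul1g mulgA.
rewrite (par_commute (retr_in evenG S g) (letter_par evenG lT)).
by rewrite -mulgA -IH.
Qed.
End CommutingParabolics.

Lemma par1_deg v g : g \in par [set v] -> g = zpow (gen v) (deg v g).
Proof.
move: g; apply: (par_ind evenG) => [|[b w] g /set1P /= -> _ IH].
  by rewrite deg1.
rewrite degM // zpowD -IH letterE; congr (_ * _).
by case: b; rewrite ?degV // deg_gen // eqxx.
Qed.

Definition root_closed_in (W : {set V}) := forall (S : {set V}) g n,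
  S \subset W -> g \in par W -> 0 < n -> g ^+ n \in par S -> g \in par S.

(** * Removing one vertex *)

Section Step.
Variables (W : {set V}) (v : V).
Hypothesis vW : v \in W.
Hypothesis IH : forall W' : {set V}, W' \proper W -> root_closed_in W'.
Variables (n : nat).
Hypothesis n0 : 0 < n.

Lemma step_not_star g : v |: link G W v != W ->
  g \in par W -> g ^+ n \in par (W :\ v) -> g \in par (W :\ v).
Proof.
move=> nW gW.
apply: (factor_root_closed (star_normal_form evenG vW) (P := predT)
  _ _ gW _ n0 (t := true)) => //.
(* Both sides of the splitting are proper subsets of [W], the star by [nW], so induction gives the
   roots of link elements. *)
move=> t m s sF _ nE m0; apply: contra nE; apply: IH sF m0.
  rewrite properEneq star_set_sub // andbT; case: t; rewrite /star_set //.
  by apply: contraTneq vW => <-; rewrite !inE eqxx.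
case: t; rewrite /star_set ?subsetUr // subsetD1 link_sub linkN //.
Qed.

Lemma step_central g : {in W :\ v, forall x, commute (gen x) (gen v)} ->
  g \in par W -> g ^+ n \in par (W :\ v) -> g \in par (W :\ v).
Proof.
move=> cv gW gn.
have dj : [disjoint W :\ v & [set v]] by rewrite disjoint_sym disjoints1 !inE eqxx.
have c : {in W :\ v & [set v], forall x y, commute (gen x) (gen y)}.
  by move=> x y xW /set1P->; apply: cv.
have gE : g = retr (W :\ v) g * retr [set v] g.
  by apply: par_setU => //; rewrite setUC setD1K.
have dg : deg v g = 0%R.
  by apply: (degX_eq0 evenG n0); apply: (deg_par evenG) gn; rewrite !inE eqxx.
have rE := retr_in evenG (W :\ v) g.
have vE : v \notin W :\ v by rewrite !inE eqxx.
have dr : deg v (retr [set v] g) = 0%R.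
  by move: dg; rewrite {1}gE degM // (deg_par evenG vE rE) add0r.
by rewrite gE (par1_deg (retr_in evenG [set v] g)) dr mulg1.
Qed.

Section LargeLabel.
Variable u : V.
Hypothesis WE : v |: link G W v = W.
Hypothesis uv : adj G u v.
Hypothesis uW : u \in W.
Hypothesis luv : lab G u v != 2.

Let T := link G W u :\ v.

Lemma adj_v x : x \in W -> x != v -> adj G x v.
Proof. by rewrite -{1}WE !inE => /orP[-> //|/andP[]]. Qed.

Lemma link_v : link G W u = v |: T.
Proof. by rewrite setD1K // inE vW adj_sym uv. Qed.

Lemma star_u : star_set G W u false = T :|: [set u; v].
Proof.
rewrite /star_set link_v; apply/setP=> x.
by rewrite !in_setU !in_set1 [RHS]orbC -orbA.
Qed.

(** Here [x], [u] and [v] are pairwise adjacent; as the label of [u] and [v] is not 2, the EAFC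
    condition makes the other two labels 2. *)
Lemma commute_T : {in T & [set u; v], forall x y, commute (gen x) (gen y)}.
Proof.
move=> x y; rewrite !inE => /and3P[xv xW xu].
have xv' := adj_v xW xv.
have := (proj2 FC) x u v xu uv xv'; rewrite (negPf luv).
case: eqP => // lxu; case: eqP => // lxv _ /orP[]/eqP->; exact: gen_commute.
Qed.

Lemma disjoint_T : [disjoint T & [set u; v]].
Proof.
rewrite disjoint_sym disjoint_subset; apply/subsetP=> x.
by rewrite !inE => /orP[]/eqP->; rewrite ?eqxx // (negPf (adj_irr G u)) !andbF.
Qed.

Lemma T_sub : T \subset W :\ v.
Proof. by rewrite setSD // link_sub. Qed.

(** The component of [s] in [par T] is in [par Q] anyway; the dihedral component has a power in [par
    [set y]]. Both orders of the pair occur: [y = v] for the link of [u], and [y = u] for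
    [W :\ v]. *)
Lemma star_root_closed (Q : {set V}) y z s m : adj G y z ->
  [set y; z] = [set u; v] -> T \subset Q -> y \in Q -> z \notin Q ->
  s \in par (T :|: [set u; v]) -> 0 < m -> s ^+ m \in par Q -> s \in par Q.
Proof.
move=> yz yzE TQ yQ zQ sB m0 sm.
rewrite (par_setU commute_T disjoint_T sB) (closedM (parC Q)) //.
  exact: par_retr_sub.
have yQ1 : [set y] \subset Q by rewrite sub1set.
apply: (par_sub evenG yQ1).
apply: (dihedral_root_closed evenG yz _ m0); first by rewrite yzE retr_in.
rewrite -retrX //; apply: (par_sub evenG _ (retr_par evenG _ sm)).
rewrite -yzE; apply/subsetP=> x; rewrite !inE => /andP[/orP[//|/eqP->]].
by rewrite (negPf zQ).
Qed.

Let L := star_nf evenG W u.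
Let nfL := star_normal_form evenG uW.

(** Induction covers the side [W :\ u]; on the star of [u], possibly all of [W], [star_root_closed]
    takes its place. *)
Lemma large_label_free t m : {in star_factor W u t, forall s : artin G,
  predT s -> s \notin par (link G W u) -> 0 < m ->
  s ^+ m \notin par (link G W u)}.
Proof.
move=> s sF _ nE m0; apply: contra nE => sm; move: sF; rewrite /star_factor.
case: t; last first.
  rewrite star_u => sF; apply: star_root_closed sF m0 sm.
  - by rewrite adj_sym; exact: uv.
  - exact: setUC.
  - by rewrite link_v subsetUr.
  - by rewrite link_v setU11.
  - exact: linkN.
move=> sF; apply: IH sF m0 sm; first by rewrite properD1.
by rewrite subsetD1 link_sub linkN.
Qed.

(* If [g ^+ n] lies in [par (W :\ v)], so do the syllables of its normal form.
   When [g] has even length its normal form is a prefix of that of [g ^+ n],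
   so [g = p * v ^ j] with [p] in [par (W :\ v)], and the degree in [v]
   gives [j = 0]. When the length is odd, the first syllable of [g] is one of
   [g ^+ n] and conjugating by it shortens [g]. *)
Lemma step_large_label g :
  g \in par W -> g ^+ n \in par (W :\ v) -> g \in par (W :\ v).
Proof.
have uv' : u != v by apply: contraTneq uv => ->; apply: adj_irr.
have vQ : v \notin W :\ v by rewrite !inE eqxx.
have [k] := ubnP (size (L g)); elim: k g => // k IHk g gk gW gn.
have Ln := star_nf_par evenG uW (subD1set W v) gn.
have [g1|g1] := leqP (size (L g)) 1.
  (* Length at most 1 puts [g] in a factor: in [par (W :\ u)] induction applies to the intersection
     with [W :\ v], and on the star of [u] the dihedral case decides. *)
  have [[] gF] := nf_factor nfL gW g1.
    have gu : g \in par (W :\ u) := gF.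
    have gnu : g ^+ n \in par (W :\ u) by rewrite (closedX (parC _)).
    have : g \in par ((W :\ u) :&: (W :\ v)).
      apply: IH gu n0 (par_setI gnu gn); first by rewrite properD1.
      exact: subsetIl.
    by apply: par_sub => //; apply: subsetIr.
  rewrite /factor /= /star_factor star_u in gF.
  apply: (star_root_closed uv _ _ _ vQ gF n0 gn) => //; first exact: T_sub.
  by rewrite !inE uv' uW.
have [og|og] := boolP (odd (size (L g))).
  have [_ hd] := nf_power nfL (P := predT) (fun _ _ => erefl)
    large_label_free gW isT n0 g1.
  case Lg : (L g) => [|[t m] s]; first by rewrite Lg in g1.
  have mQ : m \in par (W :\ v).
    move: hd Ln; rewrite -!/(L _) Lg; case: (L _) => // x s' [->] /=.
    by case/andP.
  have mW : m \in par W by apply: par_sub mQ => //; apply: subD1set.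
  have s0 : s != [::] by move: g1; rewrite Lg; case: (s).
  have := size_nf_conj nfL gW Lg og s0; set g' := m^-1 * g * m => g'g.
  have g'W : g' \in par W by rewrite !(closedM (parC W)) ?(closedV (parC W)).
  have g'n : g' ^+ n \in par (W :\ v).
    have -> : g' ^+ n = m^-1 * g ^+ n * m.
      by have := conjg_expg m^-1 g n; rewrite invgK.
    by rewrite !(closedM (parC _)) ?(closedV (parC _)).
  have g'Q : g' \in par (W :\ v).
    by apply: IHk => //; apply: leq_trans g'g _; rewrite -ltnS.
  have -> : g = m * g' * m^-1 by rewrite /g' ?gnorm.
  have mVQ := closedV (parC _) mQ.
  by rewrite (closedM (parC _)) // (closedM (parC _)).
have [y gnE] := nf_power_even nfL gW n0 og.
have pQ : sprod (L g) \in par (W :\ v).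
  move: Ln; rewrite gnE all_cat => /andP[+ _]; rewrite -/(L g).
  elim: (L g) => [|x s IHs] /=; first by rewrite (closed1 (parC _)).
  by case/andP=> xQ /IHs; apply: (closedM (parC _)).
have := nf_coset nfL gW; rewrite -/(L g); set e := _ * g => eE.
have gE : g = sprod (L g) * e by rewrite mulVKg.
have de : deg v e = 0%R.
  have: deg v g = 0%R by apply: (degX_eq0 evenG n0); apply: (deg_par evenG) gn.
  by rewrite gE degM // (deg_par evenG vQ pQ) add0r.
have vT : v \notin T by rewrite !inE eqxx.
have eT : e = retr T e * retr [set v] e.
  apply: par_setU; last by rewrite setUC -link_v.
    by move=> x z xT /set1P->; apply: commute_T => //; rewrite !inE eqxx orbT.
  by rewrite disjoint_sym disjoints1.
have dr : deg v (retr [set v] e) = 0%R.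
  by move: de; rewrite {1}eT degM // (deg_par evenG vT (retr_in evenG T e)) add0r.
rewrite gE (closedM (parC _)) // eT (par1_deg (retr_in evenG [set v] e)) dr mulg1.
by rewrite (par_retr_sub evenG) // T_sub.
Qed.

End LargeLabel.

Lemma step g : g \in par W -> g ^+ n \in par (W :\ v) -> g \in par (W :\ v).
Proof.
have [WE|] := eqVneq (v |: link G W v) W; last exact: step_not_star.
have [/exists_inP[u /setD1P[uv uW] luv]|/exists_inPn l2] :=
  boolP [exists u in W :\ v, lab G u v != 2].
  by apply: (step_large_label (u := u)) => //; apply: adj_v.
apply: step_central => x xW; have /negbNE/eqP := l2 _ xW.
by apply: gen_commute; case/setD1P: xW => xv xW; apply: adj_v.
Qed.

End Step.

Lemma root_closedP W : root_closed_in W.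
Proof.
have [k] := ubnP #|W|; elim: k W => // k IHk W Wk S g n SW gW n0 gn.
have [->//|nSW] := eqVneq S W.
have /properP[_ [v vW vS]] : S \proper W by rewrite properEneq nSW.
have SWv : S \subset W :\ v by rewrite subsetD1 SW.
have IH (W' : {set V}) : W' \proper W -> root_closed_in W'.
  by move=> W'W; apply: IHk; apply: leq_trans (proper_card W'W) _.
have gv : g \in par (W :\ v) by apply: (step vW IH n0 gW); apply: par_sub gn.
by apply: IH gv n0 gn => //; rewrite properD1.
Qed.

Lemma par_root_closed S g n : 0 < n -> g ^+ n \in par S -> g \in par S.
Proof.
apply: (root_closedP (subsetT S)).
elim/artin_ind: g => [|l g]; first exact: closed1 (parC _).
by apply: (closedM (parC _)); apply: letter_par => //; rewrite inE.
Qed.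

(** * Parabolic subgroups as predicates on words *)

Lemma is_parabolicP Q : is_parabolic G Q ->
  exists h S, forall w, Q w <-> (cls G h)^-1 * cls G w * cls G h \in par S.
Proof.
move=> [h [S QE]]; exists h, S => w; rewrite QE; split.
  move=> [u [[u' [Su' uu'] wE]]].
  rewrite (cls_eq wE) !clsM clsV ?gnorm (cls_eq uu').
  by apply/(par_wordP evenG); exists u'.
case/(par_wordP evenG)=> u Su uE; exists u; split.
  by exists u; split=> //; apply: aeq_refl.
by apply/clsP; rewrite !clsM clsV uE ?gnorm.
Qed.

Lemma cls_wpow w n : cls G (wpow w n) = zpow (cls G w) n.
Proof.
case: n => n /=; first exact: cls_nseq.
by rewrite clsM cls_nseq clsV expVgn expgSr invgM.
Qed.

(** Conjugation commutes with powers, so closure under roots passes from [par S] to its conjugates;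
    a negative exponent is handled by inverting. *)
Lemma parabolic_wpow Q g n : n != 0%R -> is_parabolic G Q -> Q (wpow g n) <-> Q g.
Proof.
move=> n0 /is_parabolicP[h [S QE]]; rewrite !QE cls_wpow.
have zJ i : (cls G h)^-1 * zpow (cls G g) i * cls G h =
    zpow ((cls G h)^-1 * cls G g * cls G h) i.
  have cX k : (cls G h)^-1 * cls G g ^+ k * cls G h =
    ((cls G h)^-1 * cls G g * cls G h) ^+ k.
    by have := conjg_expg (cls G h)^-1 (cls G g) k; rewrite invgK.
  by case: i => k; rewrite /zpow -?cX // ?gnorm.
rewrite zJ; split; last by apply: zpow_closed; apply: parC.
case: n n0 => n /= n0; first by apply: par_root_closed; rewrite lt0n.
by move=> /(closedV (parC S)); rewrite invgK; apply: par_root_closed.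
Qed.

End RootClosed.

Theorem theorem1p2 (V : finType) (G : ATsystem V) (HG : EAFC G)
  (g : word V) (n : int) (hn : n != 0%R) :
  forall w : word V,
    pclosure G (fun y => y = g) w <-> pclosure G (fun y => y = wpow g n) w.
Proof.
(* The two intersections run over one family: a parabolic subgroup contains [g] exactly when it
   contains the power. *)
move=> w; split=> Pw Q parQ Qg; apply: (Pw Q parQ) => _ ->.
  by apply/(parabolic_wpow HG g hn parQ); apply: Qg.
by apply/(parabolic_wpow HG g hn parQ); apply: Qg.
Qed.
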